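(* Let $m$ be the Lebesgue measure, let $\gamma:[0,1]\to\mathbb{R}$ be $\gamma(x)=1-e^{-x}$, let $\mu$ be the distorted Lebesgue measure $\mu(A)=\gamma(m(A))$, and let $V$ be the Volterra-Choquet operator with respect to $\mu$, $V(f)(x)=(C)\int_{0}^{x}f(t)\,d\mu(t)$, $x\in[0,1]$. (i) As a mapping $V:C[0,1]\to C[0,1]$, $V$ is a cyclic operator, with respect to the density induced by the uniform norm. (ii) As a mapping $V:L_{p,\mu}([0,1])\to L_{p,\mu}([0,1])$, $1\le p<+\infty$, $V$ is a cyclic operator with respect to the density induced by the norm $\|\cdot\|_{L_{p,\mu}([0,1])}$.
   Context: The set function $\mu$ is defined on the $\sigma$-algebra $\mathcal{C}$ of Borel subsets (or alternatively of Lebesgue measurable subsets) of $[0,1]$. The space $C[0,1]$ consists of the continuous real-valued functions on $[0,1]$ with the uniform norm. Choquet integral: for a monotone set function $\mu$ on $\mathcal{C}$ (i.e. $\mu(\emptyset)=0$ and $\mu(A)\le\mu(B)$ for $A\subset B$), $f:[0,1]\to\mathbb{R}$ $\mathcal{C}$-measurable and $A\in\mathcal{C}$, $$(C)\int_{A}f\,d\mu=\int_{0}^{+\infty}\mu(\{\omega\in A: f(\omega)\ge\beta\})\,d\beta+\int_{-\infty}^{0}\left[\mu(\{\omega\in A: f(\omega)\ge\beta\})-\mu(A)\right]d\beta ,$$ and $(C)\int_0^x$ means $(C)\int_{[0,x]}$. Spaces: for $1\le p<+\infty$, $\mathcal{L}_{p,\mu}([0,1])$ is the set of $\mathcal{C}$-measurable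 $f:[0,1]\to\mathbb{R}$ with $(C)\int_{0}^{1}|f(t)|^{p}d\mu(t)<+\infty$; $\mathcal{N}_p$ is the set of $f\in\mathcal{L}_{p,\mu}([0,1])$ with $\left((C)\int_0^1|f|^p d\mu\right)^{1/p}=0$; $L_{p,\mu}([0,1])=\mathcal{L}_{p,\mu}([0,1])/\mathcal{N}_p$, which for this $\mu$ is a Banach space under the norm $\|f\|_{L_{p,\mu}([0,1])}=\left((C)\int_{0}^{1}|f(t)|^{p}d\mu(t)\right)^{1/p}$. Cyclicity: a (not necessarily linear) continuous operator $T:X\to X$ on a Banach space $X$ is cyclic if there exists $x\in X$ such that the linear span of $Orb(T,x)=\{x,T(x),T^{2}(x),\dots,T^{n}(x),\dots\}$ is dense in $X$. *)

(* Defs.v *)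
From HB Require Import structures.
From mathcomp Require Import all_boot all_order all_algebra ring_quotient.
From mathcomp Require Import all_classical all_reals all_analysis.
From mathcomp Require Import measurable_realfun.
From mathcomp Require Import ring lra.
Import Order.TTheory GRing.Theory Num.Theory numFieldNormedType.Exports.

Set Implicit Arguments.
Unset Strict Implicit.
Unset Printing Implicit Defensive.

Local Open Scope classical_set_scope.
Local Open Scope ring_scope.

Section cyclicity.
Context {R : numFieldType} {X : normedModType R}.

Definition Orb (T : X -> X) (x : X) : set X := range (fun n => iter n T x).

Definition lin_span (S : set X) : set X :=
  [set y | exists n (a : 'I_n -> R) (s : 'I_n -> X),
     (forall i, S (s i)) /\ y = \sum_(i < n) a i *: s i].

Definition cyclic_operator (T : X -> X) : Prop :=
  continuous T /\ exists x, dense (lin_span (Orb T x)).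

End cyclicity.

Section choquet_def.
Context {R : realType} {T : Type}.
Implicit Types (mu : set T -> R) (A : set T) (f : T -> R).

(* The sum is read in [\bar R] with +oo + -oo = -oo: a finite value means that
   both parts are finite. *)
Definition choquet mu A f : \bar R :=
  (\int[lebesgue_measure]_(b in `[0%R, +oo[) (mu (A `&` [set w | (b <= f w)%R]))%:E
   + \int[lebesgue_measure]_(b in `]-oo, 0%R])
       (mu (A `&` [set w | (b <= f w)%R]) - mu A)%:E)%E.

End choquet_def.

Section choquet_theory.
Context {R : realType} {T : Type}.
Variables (mu : set T -> R) (C : set (set T)).
Hypothesis mu0 : mu set0 = 0.
Hypothesis mu_mono : forall A B, A `<=` B -> mu A <= mu B.
Hypothesis C0 : C set0.
Hypothesis CU : forall A B, C A -> C B -> C (A `|` B).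
Hypothesis CI : forall A B, C A -> C B -> C (A `&` B).
Hypothesis mu_submod : forall A B, C A -> C B ->
  mu (A `|` B) + mu (A `&` B) <= mu A + mu B.

Lemma monset_ge0 A : 0 <= mu A.
Proof. by rewrite -mu0; apply: mu_mono. Qed.

(* Upper part of the Choquet integral; it is the whole integral when f >= 0. *)
Definition layer (f : T -> R) : \bar R :=
  (\int[lebesgue_measure]_(b in `[0%R, +oo[) (mu [set w | (b <= f w)%R])%:E)%E.

Lemma choquet_ge0E f : (forall t, 0 <= f t) -> choquet mu setT f = layer f.
Proof.
move=> f0; rewrite /choquet /layer; under eq_integral do rewrite setTI.
rewrite [X in (_ + X)%E]integral0_eq ?adde0// => b /=.
rewrite in_itv/= => b0; rewrite setTI (_ : [set w | _] = setT) ?subrr//.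
by apply/seteqP; split=> // w _ /=; exact: le_trans b0 (f0 w).
Qed.

Lemma lev_le f (a b : R) : a <= b -> mu [set w | b <= f w] <= mu [set w | a <= f w].
Proof. by move=> ab; apply: mu_mono => w /=; exact: le_trans. Qed.

Lemma lev_measurable f (D : set (measurableTypeR R)) : measurable D ->
  measurable_fun D (fun b : R => (mu [set w | b <= f w])%:E : \bar R).
Proof.
move=> mD; apply/measurable_EFinP; apply: nonincreasing_measurable => //.
by move=> a b; exact: lev_le.
Qed.

Lemma layer_ge0 f : (0 <= layer f)%E.
Proof. by apply: integral_ge0 => b _; rewrite lee_fin monset_ge0. Qed.

Lemma le_layer f g : (forall t, f t <= g t) -> (layer f <= layer g)%E.
Proof.
move=> fg; apply: ge0_le_integral => //.
- by move=> *; rewrite lee_fin monset_ge0.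
- exact: lev_measurable.
- exact: lev_measurable.
- by move=> b _; rewrite lee_fin; apply: mu_mono => w /= /le_trans; apply.
Qed.

Definition rsum (h : R) (K : nat) (f : T -> R) : R :=
  \sum_(k < K) mu [set w | k.+1%:R * h <= f w].

Let slab (h : R) (k : nat) : set R := `[k%:R * h, k.+1%:R * h[%classic.

Lemma slab_cover h : 0 < h -> `[0%R, +oo[%classic = \bigcup_k slab h k.
Proof.
move=> h0; apply/seteqP; split=> b /=.
  rewrite in_itv/= andbT => b0; exists (Num.truncn (b / h)) => //=.
  have /andP[l u] : (Num.truncn (b / h))%:R <= b / h < (Num.truncn (b / h)).+1%:R.
    by apply: truncn_itv; rewrite divr_ge0// ltW.
  by rewrite /slab/= in_itv/= -ler_pdivlMr// -ltr_pdivrMr// l u.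
case=> k _; rewrite /slab/= !in_itv/= andbT => /andP[+ _].
by apply: le_trans; rewrite mulr_ge0// ltW.
Qed.

Lemma slab_triv h : 0 < h -> trivIset setT (slab h).
Proof.
move=> h0; apply/trivIsetP => i j _ _.
wlog ij : i j / (i < j)%N => [W|_].
  by rewrite neq_lt => /orP[ij|ji]; [|rewrite setIC]; apply: W => //; rewrite ltn_eqF.
apply/seteqP; split=> b //= []; rewrite /slab/= !in_itv/= => /andP[_ u] /andP[l _].
have := le_lt_trans l u; rewrite ltr_pM2r// ltr_nat.
by rewrite ltnS leqNgt ij.
Qed.

Lemma layer_slabs f h : 0 < h ->
  layer f = (\sum_(k <oo) \int[lebesgue_measure]_(b in slab h k)
           (mu [set w | (b <= f w)%R])%:E)%E.
Proof.
move=> h0; rewrite /layer (slab_cover h0); apply: ge0_integral_bigcup.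
- by move=> k; exact: measurable_itv.
- by apply: lev_measurable; apply: bigcupT_measurable => k; exact: measurable_itv.
- by move=> *; rewrite lee_fin monset_ge0.
- exact: slab_triv.
Qed.

Lemma slab_len h k : 0 < h -> lebesgue_measure (slab h k) = h%:E.
Proof.
move=> h0; rewrite /slab lebesgue_measure_itv/= lte_fin ltr_pM2r// ltr_nat ltnSn.
by rewrite -EFinB -mulrBl -natrB// subSnn mul1r.
Qed.

Lemma slab_lb f h k : 0 < h ->
  ((h * mu [set w | (k.+1%:R * h <= f w)%R])%:E <=
   \int[lebesgue_measure]_(b in slab h k) (mu [set w | (b <= f w)%R])%:E)%E.
Proof.
move=> h0; rewrite mulrC EFinM -(slab_len k h0) -integral_cst; last exact: measurable_itv.
apply: ge0_le_integral.
- exact: measurable_itv.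
- by move=> *; rewrite lee_fin monset_ge0.
- exact: measurable_cst.
- by apply: lev_measurable; exact: measurable_itv.
- move=> b; rewrite /slab/= in_itv/= => /andP[_ /ltW u].
  by rewrite lee_fin; exact: lev_le.
Qed.

Lemma slab_ub f h k : 0 < h ->
  (\int[lebesgue_measure]_(b in slab h k) (mu [set w | (b <= f w)%R])%:E
   <= (h * mu [set w | (k%:R * h <= f w)%R])%:E)%E.
Proof.
move=> h0; rewrite mulrC EFinM -(slab_len k h0) -integral_cst; last exact: measurable_itv.
apply: ge0_le_integral.
- exact: measurable_itv.
- by move=> *; rewrite lee_fin monset_ge0.
- by apply: lev_measurable; exact: measurable_itv.
- exact: measurable_cst.
- move=> b; rewrite /slab/= in_itv/= => /andP[l _].
  by rewrite lee_fin; exact: lev_le.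
Qed.

Lemma rsum_le_layer f h K : 0 < h -> ((h * rsum h K f)%:E <= layer f)%E.
Proof.
move=> h0; rewrite (layer_slabs _ h0).
apply: le_trans (nneseries_lim_ge K _); last first.
  by move=> k _ _; apply: integral_ge0 => *; rewrite lee_fin monset_ge0.
rewrite /rsum mulr_sumr big_mkord -sumEFin.
by apply: lee_sum => k _; exact: slab_lb.
Qed.

Lemma layer_le_rsum f h c : 0 < h -> (forall K, h * rsum h K f <= c) ->
  (layer f <= (h * mu setT + c)%:E)%E.
Proof.
move=> h0 rc; rewrite (layer_slabs _ h0).
apply: lime_le.
  apply: is_cvg_nneseries => k _ _.
  by apply: integral_ge0 => *; rewrite lee_fin monset_ge0.
apply: nearW => K; rewrite big_mkord.
apply: (@le_trans _ _ (\sum_(k < K) (h * mu [set w | (k%:R * h <= f w)%R])%:E)%E).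
  by apply: lee_sum => k _; exact: slab_ub.
rewrite sumEFin lee_fin; case: K => [|K].
  by rewrite big_ord0 addr_ge0 ?mulr_ge0 ?monset_ge0 ?(ltW h0)//;
     have := rc 0; rewrite /rsum big_ord0 mulr0.
rewrite big_ord_recl lerD//.
  by rewrite ler_wpM2l ?(ltW h0)//; exact: mu_mono.
by rewrite -mulr_sumr; exact: rc.
Qed.

Lemma le_epsE (x y : \bar R) (m : R) : 0 <= m ->
  (forall h : R, 0 < h -> (x <= y + (h * m)%:E)%E) -> (x <= y)%E.
Proof.
move=> m0 H; apply/lee_addgt0Pr => e e0.
have h0 : 0 < e / (m + 1) by rewrite divr_gt0// ltr_wpDl.
apply: le_trans (H _ h0) _; rewrite leeD2l// lee_fin mulrAC ler_pdivrMr ?ltr_wpDl//.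
by rewrite ler_pM2l// lerDl.
Qed.

Lemma layer_scale f c : 0 < c -> (layer (fun t => c * f t)%R <= c%:E * layer f)%E.
Proof.
move=> c0; have [->|Jf] := eqVneq (layer f) +oo%E; first by rewrite gt0_muley ?lte_fin// leey.
have /fineK Jfin : layer f \is a fin_num by rewrite ge0_fin_numE ?layer_ge0// ltey.
apply: (@le_epsE _ _ (c * mu setT)); first by rewrite mulr_ge0 ?monset_ge0 ?ltW.
move=> h h0; have ch0 : 0 < c * h by rewrite mulr_gt0.
rewrite -Jfin -EFinM -EFinD addrC mulrA [h * c]mulrC; apply: layer_le_rsum => // K.
rewrite -mulrA ler_pM2l// -lee_fin Jfin.
rewrite (_ : rsum _ _ _ = rsum h K f) ?rsum_le_layer//.
apply: eq_bigr => k _; congr mu; apply/seteqP; split=> w /=;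
  by rewrite mulrCA ler_pM2l.
Qed.

Lemma layer0 : layer (fun=> 0%R) = 0%E.
Proof.
apply/eqP; rewrite eq_le layer_ge0 andbT.
apply: (@le_epsE _ _ (mu setT)) => [|h h0]; first exact: monset_ge0.
rewrite add0e -[h * _]addr0; apply: layer_le_rsum => // K.
rewrite /rsum big1 ?mulr0// => k _; rewrite -[RHS]mu0; congr mu.
apply/seteqP; split=> // w /=; apply/negP.
by rewrite -ltNge mulr_gt0// ltr0n.
Qed.

Definition clev (f : T -> R) := forall a, C [set w | a <= f w].

Let nsum K (phi : T -> nat) := \sum_(k < K) mu [set w | (k < phi w)%N].

(* Adding an indicator: the submodularity inequalities of the successive levels
   telescope. *)
Lemma nsum_ind K phi A : C A -> (forall k, C [set w | (k <= phi w)%N]) ->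
  nsum K (fun w => phi w + (w \in A))%N + mu ([set w | (K <= phi w)%N] `&` A)
  <= nsum K phi + mu A.
Proof.
move=> CA Cphi; rewrite /nsum; elim: K => [|K IH].
  by rewrite !big_ord0 !add0r; apply: mu_mono.
rewrite !big_ord_recr/=.
have := mu_submod (Cphi K.+1) (CI (Cphi K) CA).
rewrite (_ : _ `|` _ = [set w | (K < phi w + (w \in A))%N]); last first.
  apply/seteqP; split => w /=.
    by move=> [/leq_trans->//|[Kw Aw]]; rewrite ?leq_addr// mem_set// addn1.
  case: (pselect (A w)) => Aw; last by rewrite memNset// addn0; left.
  by rewrite mem_set// addn1 ltnS; right.
rewrite (_ : _ `&` ([set w | (K <= phi w)%N] `&` A) =
             [set w | (K.+1 <= phi w)%N] `&` A); last first.
  apply/seteqP; split=> w /= [].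
    by move=> ? [].
  by move=> Kw Aw; split => //; split => //; exact: ltnW.
lra.
Qed.

Lemma nsumD K phi psi :
  (forall k, C [set w | (k <= phi w)%N]) -> (forall k, C [set w | (k <= psi w)%N]) ->
  nsum K (fun w => phi w + psi w)%N <= nsum K phi + nsum K psi.
Proof.
move=> Cphi Cpsi.
have Cadd1 p A : C A -> (forall k, C [set w | (k <= p w)%N]) ->
    forall k, C [set w | (k <= p w + (w \in A))%N].
  move=> CA Cp k; rewrite (_ : [set w | _] = [set w | (k <= p w)%N] `|`
      ([set w | (k.-1 <= p w)%N] `&` A)).
    by apply: CU => //; exact: CI.
  apply/seteqP; split => w /=.
    case: (pselect (A w)) => Aw; last by rewrite memNset// addn0; left.
    rewrite mem_set// addn1; case: k => [_|k]; first by left.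
    by rewrite ltnS; right.
  move=> [/leq_trans->//|[Kw Aw]]; rewrite ?leq_addr// mem_set// addn1.
  by case: k Kw => //= k; rewrite ltnS.
have main n : (forall k, C [set w | (k <= phi w + minn (psi w) n)%N]) /\
    nsum K (fun w => phi w + minn (psi w) n)%N <= nsum K phi + nsum n psi.
  elim: n => [|n [Cn IH]].
    have -> : (fun w => phi w + minn (psi w) 0)%N = phi.
      by apply/funext => w; rewrite minn0 addn0.
    split; first by move=> k; under eq_set do rewrite minn0 addn0; exact: Cphi.
    by rewrite [nsum 0 _]big_ord0 addr0.
  have E : (fun w => phi w + minn (psi w) n.+1)%N =
     (fun w => (phi w + minn (psi w) n) + (w \in [set w | (n.+1 <= psi w)%N]))%N.
    apply/funext => w; rewrite -addnA; congr addn.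
    case: (boolP (n.+1 <= psi w)%N) => h.
      by rewrite mem_set// (minn_idPr h) (minn_idPr (ltnW h)) addn1.
    rewrite memNset ?addn0 /=; last exact/negP.
    rewrite -leqNgt in h.
    by rewrite (minn_idPl h) (minn_idPl (leqW h)).
  split.
    move=> k; have := @Cadd1 _ _ (Cpsi n.+1) Cn k.
    by congr (C _); apply/seteqP; split=> w /=;
      have /(congr1 (@^~ w)) /= := E => ->.
  rewrite E; have := @nsum_ind K _ _ (Cpsi n.+1) Cn.
  have := monset_ge0 ([set w | (K <= phi w + minn (psi w) n)%N] `&` [set w | (n < psi w)%N]).
  have -> : nsum n.+1 psi = nsum n psi + mu [set w | (n < psi w)%N].
    by rewrite /nsum big_ord_recr.
  lra.
apply: le_trans (main K).2; rewrite le_eqVlt; apply/orP; left; apply/eqP.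
apply: eq_bigr => k _; congr mu; apply/seteqP; split => w /=.
  by move=> h; case: (leqP (psi w) K) => // p; rewrite ltn_addl.
by move/leq_trans; apply; rewrite leq_add2l geq_minl.
Qed.

Lemma layer_add f g : (forall t, 0 <= f t) -> (forall t, 0 <= g t) ->
  clev f -> clev g -> (layer (fun t => f t + g t)%R <= layer f + layer g)%E.
Proof.
move=> f0 g0 Cf Cg.
have [->|Jf] := eqVneq (layer f) +oo%E.
  by rewrite addye ?leey// gt_eqF// (lt_le_trans _ (layer_ge0 g)).
have [->|Jg] := eqVneq (layer g) +oo%E.
  by rewrite addey ?leey// gt_eqF// (lt_le_trans _ (layer_ge0 f)).
have /fineK Jffin : layer f \is a fin_num by rewrite ge0_fin_numE ?layer_ge0// ltey.
have /fineK Jgfin : layer g \is a fin_num by rewrite ge0_fin_numE ?layer_ge0// ltey.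
apply: (@le_epsE _ _ (3 * mu setT)); first by rewrite mulr_ge0 ?monset_ge0.
move=> h h0.
have trlev (u : T -> R) : (forall t, 0 <= u t) -> forall k,
    [set w | (k <= Num.truncn (u w / h))%N] = [set w | k%:R * h <= u w].
  move=> u0 k; apply/seteqP; split=> w /=;
  by rewrite truncn_ge_nat ?divr_ge0 ?(ltW h0)// ler_pdivlMr.
have trC (u : T -> R) : (forall t, 0 <= u t) -> clev u ->
    forall k, C [set w | (k <= Num.truncn (u w / h))%N].
  by move=> u0 Cu k; rewrite trlev.
have nr K u : (forall t, 0 <= u t) ->
    nsum K (fun w => Num.truncn (u w / h)) = rsum h K u.
  by move=> u0; apply: eq_bigr => k _; rewrite (trlev _ u0 k.+1).
have key K : h * rsum h K (fun t => f t + g t) <=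
   2 * h * mu setT + (fine (layer f) + fine (layer g)).
  have kf : h * rsum h K f <= fine (layer f) by rewrite -lee_fin Jffin rsum_le_layer.
  have kg : h * rsum h K g <= fine (layer g) by rewrite -lee_fin Jgfin rsum_le_layer.
  have n1 := nsumD K (trC _ f0 Cf) (trC _ g0 Cg).
  rewrite !nr// in n1.
  have n2 : rsum h K (fun t => f t + g t) <= 2 * mu setT +
     nsum K (fun w => (Num.truncn (f w / h) + Num.truncn (g w / h))%N).
    have st k : mu [set w | k.+2%:R * h <= f w + g w] <=
        mu [set w | (k < Num.truncn (f w / h) + Num.truncn (g w / h))%N].
      apply: mu_mono => w /=; rewrite -ler_pdivlMr// mulrDl => H.
      have /andP[_ uf] := truncn_itv (divr_ge0 (f0 w) (ltW h0)).
      have /andP[_ ug] := truncn_itv (divr_ge0 (g0 w) (ltW h0)).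
      have := le_lt_trans H (ltrD uf ug).
      by rewrite -natrD ltr_nat addnS addSn !ltnS.
    case: K {kf kg n1} => [|K].
      by rewrite /rsum/nsum !big_ord0 addr0 mulr_ge0// monset_ge0.
    rewrite /rsum big_ord_recl [X in _ + X <= _](_ : _ =
       \sum_(i < K) mu [set w | i.+2%:R * h <= f w + g w])//.
    rewrite /nsum big_ord_recr/= -!/(nsum _ _).
    set N := nsum K _; set c := mu [set w | (K < _)%N].
    have -> : 2 * mu setT + (N + c) = (mu setT + N) + (mu setT + c) by ring.
    apply: ler_wpDr; first by rewrite addr_ge0// monset_ge0.
    apply: lerD; first exact: mu_mono.
    by apply: ler_sum => i _; exact: st.
  have : h * rsum h K (fun t => f t + g t) <=
    h * (2 * mu setT + (rsum h K f + rsum h K g)).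
    by rewrite ler_pM2l// (le_trans n2)// lerD2l.
  rewrite !mulrDr; lra.
rewrite -Jffin -Jgfin -!EFinD.
have := layer_le_rsum h0 key; move/le_trans; apply.
by rewrite lee_fin; lra.
Qed.

End choquet_theory.

Definition I01 (R : realType) : set R := `[0%R, 1%R]%classic.
Arguments I01 R : clear implicits.

Section distorted_lebesgue.
Context {R : realType}.

(* [lebesgue_measure] is the restriction of a total outer measure, so it also
   gives the measure of the sets that are Lebesgue but not Borel measurable. *)
Definition leb01 (A : set (I01 R)) : R :=
  fine (lebesgue_measure (set_val @` A)).

Definition distortion (x : R) : R := 1 - expR (- x).

Definition mu01 (A : set (I01 R)) : R := distortion (leb01 A).

Notation leb := (@lebesgue_measure R).
Notation om := ((wlength (@idfun R))^*)%mu.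

Lemma leb_mono (A B : set R) : A `<=` B -> (leb A <= leb B)%E.
Proof. by move=> AB; apply: (@le_outer_measure R _ om). Qed.

Lemma leb_fin (A : set (I01 R)) : leb (set_val @` A) \is a fin_num.
Proof.
rewrite ge0_fin_numE; last exact: (@outer_measure_ge0 R _ om).
apply: (@le_lt_trans _ _ (leb `[0%R, 1%R]%classic)).
  by apply: leb_mono => _ [[x Ix] _ <-]; exact: set_mem Ix.
by rewrite lebesgue_measure_itv/= lte_fin ltr01 -EFinB ltry.
Qed.

Lemma leb01_mono A B : A `<=` B -> leb01 A <= leb01 B.
Proof.
move=> AB; apply: fine_le; rewrite ?leb_fin//.
exact/leb_mono/image_subset.
Qed.

Lemma leb01_0 : leb01 set0 = 0.
Proof. by rewrite /leb01 image_set0 measure0. Qed.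

Lemma mu01_0 : mu01 set0 = 0.
Proof. by rewrite /mu01 /distortion leb01_0 oppr0 expR0 subrr. Qed.

Lemma mu01_mono A B : A `<=` B -> mu01 A <= mu01 B.
Proof.
by move=> AB; rewrite /mu01 /distortion lerD2l lerN2 ler_expR lerN2; exact: leb01_mono.
Qed.

End distorted_lebesgue.

Inductive sigma_alg := Borel | Lebesgue.

Section sigma_algebras.
Context {R : realType}.
Variable c : sigma_alg.

Definition csets : set (set (I01 R)) := [set A |
  match c with
  | Borel => measurable (set_val @` A : set R)
  | Lebesgue => completed_algebra_gen lebesgue_measure (set_val @` A : set R)
  end].

(* [0, 1] equipped with the sigma-algebra [csets]. *)
Definition I01c : Type := let _ := c in I01 R.

Notation leb := (@lebesgue_measure R).
Notation om := ((wlength (@idfun R))^*)%mu.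

Definition rsets : set (set R) :=
  match c with Borel => measurable | Lebesgue => completed_algebra_gen leb end.

Lemma csetsE A : csets A = rsets (set_val @` A).
Proof. by rewrite /csets /rsets /=; case: c. Qed.

Lemma rsets_cara A : rsets A -> om.-caratheodory A.
Proof.
have H : forall B, (completed_algebra_gen leb).-sigma.-measurable B -> om.-caratheodory B.
  by move=> B; rewrite completed_caratheodory_measurable.
rewrite /rsets; case: c => mA.
  exact: (@sub_caratheodory _ (ocitv_type R)).
by apply: H; rewrite g_sigma_completed_algebra_genE.
Qed.

Lemma rsets_borel A : measurable A -> rsets A.
Proof.
rewrite /rsets; case: c => // mA; exists A => //; exists set0; last by rewrite setU0.
exact: negligible_set0.
Qed.

Lemma rsetsC A : rsets A -> rsets (~` A).
Proof.
rewrite /rsets; case: c => [|]; first exact: measurableC.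
by rewrite -g_sigma_completed_algebra_genE; exact: measurableC.
Qed.

Lemma rsets_bigcup (F : (set R)^nat) : (forall i, rsets (F i)) -> rsets (\bigcup_i F i).
Proof.
rewrite /rsets; case: c => [|]; first exact: bigcupT_measurable.
by rewrite -g_sigma_completed_algebra_genE; exact: bigcupT_measurable.
Qed.

Lemma rsetsI A B : rsets A -> rsets B -> rsets (A `&` B).
Proof.
rewrite /rsets; case: c => [|]; first exact: measurableI.
by rewrite -g_sigma_completed_algebra_genE; exact: measurableI.
Qed.

Lemma image_valC (A : set (I01 R)) : set_val @` (~` A) = I01 R `&` ~` (set_val @` A).
Proof.
apply/seteqP; split=> x /=.
  by move=> [t At <-]; split; [exact: set_valP|case=> s As /val_inj st; rewrite st in As].
move=> [Ix nA]; exists (exist _ x (mem_set Ix)) => // Ax.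
by apply: nA; exists (exist _ x (mem_set Ix)).
Qed.

Lemma csets0 : csets set0.
Proof. by rewrite csetsE image_set0; exact: rsets_borel. Qed.

Lemma csetsC A : csets A -> csets (~` A).
Proof.
rewrite !csetsE image_valC => mA; apply: rsetsI; last exact: rsetsC.
by apply: rsets_borel; exact: measurable_itv.
Qed.

Lemma csets_bigcup (F : (set (I01 R))^nat) :
  (forall i, csets (F i)) -> csets (\bigcup_i F i).
Proof.
move=> CF; rewrite csetsE image_bigcup; apply: rsets_bigcup => i.
by rewrite -csetsE.
Qed.

Let pt : I01 R.
Proof. by exists 0; rewrite inE /I01/= in_itv/= lexx ler01. Qed.

HB.instance Definition _ := gen_eqMixin I01c.
HB.instance Definition _ := gen_choiceMixin I01c.
HB.instance Definition _ := isPointed.Build I01c pt.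
HB.instance Definition _ := @isMeasurable.Build default_measure_display I01c
  csets csets0 csetsC csets_bigcup.

Lemma leb01_add A B : csets A -> csets B ->
  leb01 (A `|` B) + leb01 (A `&` B) = leb01 A + leb01 B.
Proof.
rewrite !csetsE => /rsets_cara mA /rsets_cara mB.
rewrite /leb01 -!fineD ?leb_fin//; congr fine.
rewrite -[_ + _]/(om (set_val @` (A `|` B)) + om (set_val @` (A `&` B)))%E.
have e1 := mA (set_val @` (A `|` B)).
have e2 := mA (set_val @` B).
rewrite -[leb]/om.
have i1 : set_val @` (A `|` B) `&` set_val @` A = set_val @` A :> set R.
  apply/seteqP; split => x /=; first by case.
  by move=> [t At <-]; split; exists t => //; left.
have i2 : set_val @` (A `|` B) `&` ~` (set_val @` A) = set_val @` B `&` ~` (set_val @` A) :> set R.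
  apply/seteqP; split => x /=.
    by move=> [[t [At|Bt] <-] nA]; [exfalso; apply: nA|]; [exists t|split => //; exists t].
  by move=> [[t Bt <-] nA]; split => //; exists t => //; right.
have i3 : set_val @` B `&` set_val @` A = set_val @` (A `&` B) :> set R.
  apply/seteqP; split => x /=.
    by move=> [[t Bt <-] [s As /val_inj st]]; exists t => //; split => //; rewrite -st.
  by move=> [t [At Bt] <-]; split; exists t.
rewrite e1 i1 i2 [X in _ = (_ + X)%E]e2 i3.
by rewrite -!addeA; congr (_ + _)%E; rewrite addeC.
Qed.

Lemma mu01_submod A B : csets A -> csets B ->
  mu01 (A `|` B) + mu01 (A `&` B) <= mu01 A + mu01 B.
Proof.
move=> cA cB; have := leb01_add cA cB.
have l1 : leb01 (A `&` B) <= leb01 A by apply: leb01_mono; exact: subIsetl.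
have l2 : leb01 (A `&` B) <= leb01 B by apply: leb01_mono; exact: subIsetr.
rewrite /mu01 /distortion.
move: l1 l2; set x := leb01 (A `&` B); set a := leb01 A; set b := leb01 B.
set u := leb01 _ => l1 l2 uE.
have -> : - u = - x + (- (a - x) + - (b - x)) by lra.
have -> : - a = - x + - (a - x) by lra.
have -> : - b = - x + - (b - x) by lra.
rewrite !expRD; set X := expR (- x); set P := expR _; set Q := expR _.
have X0 : 0 <= X by exact: expR_ge0.
have P1 : P <= 1 by rewrite -[1]expR0 ler_expR; lra.
have Q1 : Q <= 1 by rewrite -[1]expR0 ler_expR; lra.
have : 0 <= X * ((1 - P) * (1 - Q)) by rewrite !mulr_ge0// subr_ge0.
lra.
Qed.

End sigma_algebras.
Arguments I01c R c : clear implicits.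

Section C01_def.
Context {R : realType}.

Definition cont01 : {pred I01 R -> R} := [pred f : I01 R -> R | `[< continuous f >]].

Lemma cont01_submod : submod_closed cont01.
Proof.
split; first by apply/asboolP => x; exact: cst_continuous.
move=> a f g /asboolP cf /asboolP cg; apply/asboolP => x.
by apply: continuousD; [apply: continuousM; [exact: cst_continuous|exact: cf]|exact: cg].
Qed.

HB.instance Definition _ := GRing.isSubmodClosed.Build R _ cont01 cont01_submod.

Record C01 := MkC01 { C01_fun :> I01 R -> R; _ : C01_fun \in cont01 }.

HB.instance Definition _ := [isSub of C01 for C01_fun].
HB.instance Definition _ := [Choice of C01 by <:].
HB.instance Definition _ := [SubChoice_isSubLmodule of C01 by <:].

Definition unorm (f : C01) : R := sup [set `|f x| | x in [set: I01 R]].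

Lemma C01_bounded (f : C01) : has_ubound [set `|f x| | x in [set: I01 R]].
Proof.
case: f => f /= /asboolP cf.
have cF : {within I01 R, continuous (Num.norm \o valL_ (0:R) f)}.
  have cv : {within I01 R, continuous (valL_ (0:R) f)} by apply/subspace_valL_continuousP'.
  by move=> x; apply: cvg_norm; exact: cv.
have [b _ Hb] := EVT_max ler01 cF.
exists ((Num.norm \o valL_ 0 f) b) => _ [x _ <-].
have := Hb (val x); rewrite -[f x]/((f : I01 R -> R) x) /=.
have xI : val x \in `[0, 1]%R by have := valP x; rewrite inE.
move=> /(_ xI); congr (_ <= _).
have /(congr1 (@^~ x)) := valLK (0 : R) f.
by rewrite /sigL/= => <-.
Qed.

Lemma C01_nonempty (f : C01) : [set `|f x| | x in [set: I01 R]] !=set0.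
Proof. by exists `|f (@point (I01c R Borel))|; exists (@point (I01c R Borel)). Qed.

Lemma unorm_ub (f : C01) x : `|f x| <= unorm f.
Proof. by apply: ub_le_sup; [exact: C01_bounded|exists x]. Qed.

Lemma unormD (f g : C01) : unorm (f + g) <= unorm f + unorm g.
Proof.
apply: ge_sup; first exact: C01_nonempty.
move=> _ [x _ <-]; apply: le_trans (ler_normD _ _) _.
by apply: lerD; exact: unorm_ub.
Qed.

Lemma unormZ (a : R) (f : C01) : unorm (a *: f) = `|a| * unorm f.
Proof.
have le1 b (g : C01) : unorm (b *: g) <= `|b| * unorm g.
  apply: ge_sup; first exact: C01_nonempty.
  move=> _ [x _ <-]; rewrite -[(b *: g) x]/(b * g x) normrM.
  by rewrite ler_wpM2l// unorm_ub.
apply/eqP; rewrite eq_le le1/=.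
have [->|a0] := eqVneq a 0.
  rewrite normr0 mul0r; apply: le_trans (unorm_ub _ (@point (I01c R Borel))).
  exact: normr_ge0.
rewrite -ler_pdivlMl ?normr_gt0// -normfV.
by rewrite -{1}[f]scale1r -(mulVf a0) -scalerA.
Qed.

Lemma unorm_eq0 (f : C01) : unorm f = 0 -> f = 0.
Proof.
move=> f0; apply/val_inj/funext => x; apply/eqP.
by rewrite -normr_le0 -f0 unorm_ub.
Qed.

HB.instance Definition _ := Lmodule_isNormed.Build R C01 unormD unormZ unorm_eq0.

End C01_def.
Arguments C01 : clear implicits.

Section Lp.
Context {R : realType}.
Variables (c : sigma_alg) (p : R) (hp : 1 <= p).
Implicit Types f g : I01 R -> R.

Definition Lpow f : I01 R -> R := fun t => `|f t| `^ p.

(* The proof [hp] is an argument because the linear structure depends on it. *)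
Definition calL_pred : {pred I01 R -> R} := [pred f | let _ := hp in
  `[< measurable_fun [set: I01c R c] (f : I01c R c -> R) /\
      (choquet mu01 setT (Lpow f) < +oo)%E >]].

Definition Lpnorm f : R := fine (choquet mu01 setT (Lpow f)) `^ p^-1.

Let Jm := layer (@mu01 R).

Lemma Lp_exp_gt0 : 0 < p. Proof. exact: lt_le_trans ltr01 hp. Qed.

Lemma Lpow_ge0 f t : 0 <= Lpow f t. Proof. exact: powR_ge0. Qed.

Lemma choquetJ f : choquet mu01 setT (Lpow f) = Jm (Lpow f).
Proof. by rewrite choquet_ge0E// => t; exact: powR_ge0. Qed.

Lemma Jm_ge0 f : (0 <= Jm f)%E.
Proof. by apply: layer_ge0; [exact: mu01_0|exact: mu01_mono]. Qed.

Lemma Lpow_clev f k : measurable_fun [set: I01c R c] (f : I01c R c -> R) ->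
  clev (csets c) (fun t => k * Lpow f t).
Proof.
move=> mf a.
have mh : measurable_fun [set: I01c R c] ((fun t => k * Lpow f t) : I01c R c -> R).
  apply: measurable_funM; first exact: measurable_cst.
  apply: (measurableT_comp (measurable_powR _)) => //.
  exact: measurableT_comp.
have := mh measurableT `[a, +oo[%classic (measurable_itv _).
rewrite setTI; congr (csets c _); apply/seteqP; split=> t /=;
  by rewrite in_itv/= andbT.
Qed.

Lemma Lpow_convex f g (a b : R) t : 0 < a -> 0 < b ->
  Lpow (f + g) t <= (a + b) `^ p * (a / (a + b)) / a `^ p * Lpow f t
                   + (a + b) `^ p * (b / (a + b)) / b `^ p * Lpow g t.
Proof.
move=> a0 b0; have ab0 : 0 < a + b by rewrite addr_gt0.
have w0 : 0 <= a / (a + b) by rewrite divr_ge0 ?(ltW ab0) ?(ltW a0).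
have w1 : a / (a + b) <= 1 by rewrite ler_pdivrMr// mul1r lerDl (ltW b0).
have := @convex_powR R p hp (Itv01 w0 w1) (`|f t| / a) (`|g t| / b).
rewrite !inE/= !in_itv/= !andbT !divr_ge0 ?(ltW a0) ?(ltW b0)// => /(_ isT isT).
rewrite convRE [X in X `^ _ <= _]convRE/= /unstable.onem.
have -> : 1 - a / (a + b) = b / (a + b) by field; rewrite gt_eqF.
have -> : a / (a + b) * (`|f t| / a) + b / (a + b) * (`|g t| / b) =
   (a + b)^-1 * (`|f t| + `|g t|) by field; rewrite !gt_eqF.
rewrite powRM ?addr_ge0 ?invr_ge0 ?(ltW ab0)// !powRM ?invr_ge0 ?(ltW a0) ?(ltW b0)// => H.
have vE (x : R) : 0 < x -> x^-1 `^ p = (x `^ p)^-1.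
  by move=> x0; rewrite -powR_inv1 ?ltW// -powRrM mulN1r powRN.
rewrite !vE// in H.
have P0 : 0 < (a + b) `^ p by rewrite powR_gt0.
have H2 : Lpow (f + g) t <= (`|f t| + `|g t|) `^ p.
  rewrite /Lpow ge0_ler_powR ?nnegrE ?addr_ge0 ?(ltW Lp_exp_gt0)//.
  exact: ler_normD.
apply: le_trans H2 _.
rewrite ler_pdivrMl// in H; apply: le_trans H _.
by rewrite /Lpow le_eqVlt; apply/orP; left; apply/eqP; ring.
Qed.

Lemma calLP f : reflect (measurable_fun [set: I01c R c] (f : I01c R c -> R) /\
  (Jm (Lpow f) < +oo)%E) (f \in calL_pred).
Proof. by rewrite inE/= choquetJ; exact: asboolP. Qed.

Lemma LpnormE f : f \in calL_pred -> Jm (Lpow f) = (Lpnorm f `^ p)%:E.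
Proof.
move=> /calLP[mf fin]; rewrite /Lpnorm choquetJ -powRrM mulVf ?gt_eqF ?Lp_exp_gt0//.
by rewrite powRr1 ?fine_ge0 ?Jm_ge0// fineK// ge0_fin_numE// Jm_ge0.
Qed.

Lemma Lpnorm_ge0 f : 0 <= Lpnorm f. Proof. exact: powR_ge0. Qed.

Lemma Lpnorm_le f d : 0 <= d -> (Jm (Lpow f) <= (d `^ p)%:E)%E -> Lpnorm f <= d.
Proof.
move=> d0 H.
have fin : Jm (Lpow f) \is a fin_num.
  by rewrite ge0_fin_numE ?Jm_ge0// (le_lt_trans H)// ltry.
rewrite -(powRr1 d0) -(mulfV (lt0r_neq0 Lp_exp_gt0)) powRrM /Lpnorm choquetJ.
rewrite ge0_ler_powR ?nnegrE ?invr_ge0 ?powR_ge0 ?fine_ge0 ?Jm_ge0 ?(ltW Lp_exp_gt0)//.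
by rewrite -lee_fin fineK.
Qed.

Lemma mink_aux f g a b : f \in calL_pred -> g \in calL_pred ->
  Lpnorm f < a -> Lpnorm g < b -> (Jm (Lpow (f + g)%R) <= ((a + b) `^ p)%:E)%E.
Proof.
move=> Lf Lg fa gb.
have a0 := le_lt_trans (Lpnorm_ge0 f) fa.
have b0 := le_lt_trans (Lpnorm_ge0 g) gb.
have ab0 : 0 < a + b by rewrite addr_gt0.
have [mf _] := calLP _ Lf; have [mg _] := calLP _ Lg.
set k1 := (a + b) `^ p * (a / (a + b)) / a `^ p.
set k2 := (a + b) `^ p * (b / (a + b)) / b `^ p.
have k10 : 0 < k1 by rewrite !(divr_gt0, mulr_gt0) ?powR_gt0.
have k20 : 0 < k2 by rewrite !(divr_gt0, mulr_gt0) ?powR_gt0.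
have H1 : (Jm (Lpow (f + g)%R) <= Jm (fun t => k1 * Lpow f t + k2 * Lpow g t)%R)%E.
  apply: le_layer; [exact: mu01_0|exact: mu01_mono|].
  by move=> t; exact: Lpow_convex.
apply: le_trans H1 _.
have H2 : (Jm (fun t => k1 * Lpow f t + k2 * Lpow g t)%R <=
    Jm (fun t => k1 * Lpow f t)%R + Jm (fun t => k2 * Lpow g t)%R)%E.
  apply: (@layer_add _ _ _ (csets c)).
  - exact: mu01_0.
  - exact: mu01_mono.
  - by move=> A B; exact: (@measurableU _ (I01c R c)).
  - by move=> A B; exact: (@measurableI _ (I01c R c)).
  - exact: mu01_submod.
  - by move=> t; rewrite mulr_ge0 ?Lpow_ge0 ?ltW.
  - by move=> t; rewrite mulr_ge0 ?Lpow_ge0 ?ltW.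
  - exact: Lpow_clev.
  - exact: Lpow_clev.
apply: le_trans H2 _.
have sc k u : 0 < k -> (Jm (fun t => k * u t)%R <= k%:E * Jm u)%E.
  by move=> k0; apply: layer_scale => //; [exact: mu01_0|exact: mu01_mono].
apply: le_trans (leeD (sc _ _ k10) (sc _ _ k20)) _.
rewrite !LpnormE// -!EFinM -EFinD lee_fin.
have -> : (a + b) `^ p = k1 * a `^ p + k2 * b `^ p.
  by rewrite /k1 /k2; field; rewrite !gt_eqF ?powR_gt0.
apply: lerD; rewrite ler_pM2l// ge0_ler_powR ?nnegrE ?Lpnorm_ge0 ?(ltW Lp_exp_gt0) ?ltW//.
Qed.

Lemma calL_add f g : f \in calL_pred -> g \in calL_pred -> f + g \in calL_pred.
Proof.
move=> Lf Lg; apply/calLP; split.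
  by apply: measurable_funD; [have [] := calLP _ Lf|have [] := calLP _ Lg].
have lt1 (x : R) : x < x + 1 by rewrite ltrDl.
by apply: le_lt_trans (mink_aux Lf Lg (lt1 _) (lt1 _)) _; exact: ltry.
Qed.

Lemma LpnormD f g : f \in calL_pred -> g \in calL_pred ->
  Lpnorm (f + g) <= Lpnorm f + Lpnorm g.
Proof.
move=> Lf Lg; apply/ler_addgt0Pr => e e0.
have sp (x y : R) : x + y + e = (x + e / 2) + (y + e / 2) by lra.
have e2 : 0 < e / 2 by rewrite divr_gt0.
have lt2 (x : R) : x < x + e / 2 by rewrite ltrDl.
rewrite sp.
apply: Lpnorm_le; first by rewrite addr_ge0// addr_ge0 ?Lpnorm_ge0// ltW.
exact: mink_aux.
Qed.

Lemma Lpow0 : Lpow 0 = fun=> 0.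
Proof. by apply/funext => t; rewrite /Lpow normr0 powR0// gt_eqF// Lp_exp_gt0. Qed.

Lemma calL0 : 0 \in calL_pred.
Proof.
apply/calLP; split; first exact: measurable_cst.
by rewrite Lpow0 /Jm layer0 ?ltry//; [exact: mu01_0|exact: mu01_mono].
Qed.

Lemma Lpnorm0 : Lpnorm 0 = 0.
Proof.
rewrite /Lpnorm choquetJ Lpow0 /Jm layer0; [|exact: mu01_0|exact: mu01_mono].
by rewrite powR0// invr_eq0 gt_eqF// Lp_exp_gt0.
Qed.

Lemma LpowZ k f : Lpow (k *: f) = fun t => `|k| `^ p * Lpow f t.
Proof.
by apply/funext => t; rewrite /Lpow -[(k *: f) t]/(k * f t) normrM powRM.
Qed.

Lemma calLZ_le k f : f \in calL_pred ->
  k *: f \in calL_pred /\ Lpnorm (k *: f) <= `|k| * Lpnorm f.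
Proof.
move=> Lf; have [mf _] := calLP _ Lf.
have [->|k0] := eqVneq k 0.
  by rewrite scale0r normr0 mul0r Lpnorm0 calL0.
have H : (Jm (Lpow (k *: f)%R) <= ((`|k| * Lpnorm f) `^ p)%:E)%E.
  rewrite LpowZ powRM ?Lpnorm_ge0// EFinM -LpnormE//.
  apply: layer_scale; [exact: mu01_0|exact: mu01_mono|].
  by rewrite powR_gt0// normr_gt0.
split; last by apply: Lpnorm_le => //; rewrite mulr_ge0 ?Lpnorm_ge0.
apply/calLP; split; last by apply: le_lt_trans H _; rewrite ltry.
by apply: measurable_funM => //; exact: measurable_cst.
Qed.

Lemma LpnormZ k f : f \in calL_pred -> Lpnorm (k *: f) = `|k| * Lpnorm f.
Proof.
move=> Lf; apply/eqP; rewrite eq_le (calLZ_le k Lf).2/=.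
have [->|k0] := eqVneq k 0.
  by rewrite normr0 mul0r Lpnorm_ge0.
rewrite -ler_pdivlMl ?normr_gt0// -normfV.
rewrite -{1}[f]scale1r -(mulVf k0) -scalerA.
exact: (calLZ_le _ (calLZ_le k Lf).1).2.
Qed.

Lemma calL_submod : submod_closed calL_pred.
Proof.
split; first exact: calL0.
move=> a f g Lf Lg; have [Laf _] := calLZ_le a Lf.
exact: (calL_add Laf Lg).
Qed.

HB.instance Definition _ := GRing.isSubmodClosed.Build R _ calL_pred calL_submod.

Record calL := MkCalL { calL_fun :> I01 R -> R; _ : calL_fun \in calL_pred }.

HB.instance Definition _ := [isSub of calL for calL_fun].
HB.instance Definition _ := [Choice of calL by <:].
HB.instance Definition _ := [SubChoice_isSubLmodule of calL by <:].

Definition calN : {pred calL} := [pred f : calL | Lpnorm f == 0].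

Lemma calN_zmod : zmod_closed calN.
Proof.
split; first by rewrite inE Lpnorm0.
move=> f g; rewrite !inE => /eqP f0 /eqP g0.
have Lf := valP f; have Lg := valP g.
rewrite eq_le Lpnorm_ge0 andbT.
apply: le_trans (LpnormD Lf _) _; first by rewrite -scaleN1r; exact: (calLZ_le _ Lg).1.
by rewrite -scaleN1r LpnormZ// f0 g0 mulr0 addr0.
Qed.

HB.instance Definition _ := GRing.isZmodClosed.Build calL calN calN_zmod.

Local Open Scope quotient_scope.

(* [Lclass] is the canonical surjection onto the quotient of [calL] by [calN]. *)
Definition Lp : Type := {ideal_quot calN}.

HB.instance Definition _ := Choice.on Lp.
HB.instance Definition _ := GRing.Zmodule.on Lp.

Definition Lclass (f : calL) : Lp := \pi_{ideal_quot calN} f.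

Definition Lrepr (x : Lp) : calL := repr (x : {ideal_quot calN}).

Lemma LreprK x : Lclass (Lrepr x) = x. Proof. exact: reprK. Qed.

Lemma LclassP (f g : calL) : Lclass f = Lclass g <-> Lpnorm (f - g) = 0.
Proof.
split.
  by move=> /eqP; rewrite /Lclass eqmodE /= Quotient.equivE inE => /eqP.
by move=> fg; apply/eqP; rewrite /Lclass eqmodE /= Quotient.equivE inE fg.
Qed.

Lemma LclassD (f g : calL) : Lclass (f + g) = Lclass f + Lclass g.
Proof. by rewrite /Lclass; exact: (raddfD \pi_{ideal_quot calN}). Qed.

Definition Lscale (k : R) (x : Lp) : Lp := Lclass (k *: Lrepr x).

Lemma LpnormL0 (k : R) (f : calL) : Lpnorm (k *: (f : I01 R -> R)) = `|k| * Lpnorm f.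
Proof. by apply: LpnormZ; exact: valP. Qed.

Lemma LclassZ k (f : calL) : Lclass (k *: f) = Lscale k (Lclass f).
Proof.
apply/LclassP; rewrite -[X in Lpnorm X]/(val (k *: f - k *: Lrepr (Lclass f))).
rewrite -scalerBr -[val _]/(k *: val (f - Lrepr (Lclass f))) LpnormL0.
suff -> : Lpnorm (f - Lrepr (Lclass f)) = 0 by rewrite mulr0.
by apply/LclassP; rewrite LreprK.
Qed.

Lemma LscaleA a b x : Lscale a (Lscale b x) = Lscale (a * b) x.
Proof. by rewrite -[x]LreprK -!LclassZ scalerA. Qed.

Lemma Lscale1 : left_id 1 Lscale.
Proof. by move=> x; rewrite -[x]LreprK -!LclassZ scale1r. Qed.

Lemma LscaleDr : right_distributive Lscale +%R.
Proof.
move=> a x y; rewrite -[x]LreprK -[y]LreprK -LclassD -!LclassZ.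
by rewrite scalerDr LclassD.
Qed.

Lemma LscaleDl x : {morph Lscale^~ x : a b / a + b}.
Proof.
by move=> a b; rewrite -[x]LreprK -!LclassZ scalerDl LclassD.
Qed.

HB.instance Definition _ :=
  GRing.Zmodule_isLmodule.Build R Lp LscaleA Lscale1 LscaleDr LscaleDl.

Definition Lnrm (x : Lp) : R := Lpnorm (Lrepr x).

Lemma Lnrm_class (f : calL) : Lnrm (Lclass f) = Lpnorm f.
Proof.
have H (u v : calL) : Lpnorm (u - v) = 0 -> Lpnorm u <= Lpnorm v.
  move=> uv; rewrite -[Lpnorm v]add0r -uv -[u in leLHS](subrK v).
  by rewrite -[val _]/(val (u - v) + val v); apply: LpnormD; exact: valP.
have E : Lclass (Lrepr (Lclass f)) = Lclass f by exact: LreprK.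
apply/le_anti/andP; split; apply: H; apply/LclassP; first exact: E.
exact: (esym E).
Qed.

Lemma LnrmD x y : Lnrm (x + y) <= Lnrm x + Lnrm y.
Proof.
rewrite -[x]LreprK -[y]LreprK -LclassD !Lnrm_class.
by apply: LpnormD; exact: valP.
Qed.

Lemma LnrmZ (k : R) x : Lnrm (k *: x) = `|k| * Lnrm x.
Proof.
rewrite -[x]LreprK -[k *: _]/(Lscale k _) -LclassZ !Lnrm_class.
exact: LpnormL0.
Qed.

Lemma Lnrm_eq0 x : Lnrm x = 0 -> x = 0.
Proof.
rewrite -[x]LreprK Lnrm_class => x0.
have -> : 0 = Lclass 0 by rewrite /Lclass raddf0.
by apply/LclassP; rewrite subr0.
Qed.

HB.instance Definition _ := Lmodule_isNormed.Build R Lp LnrmD LnrmZ Lnrm_eq0.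

End Lp.

Section volterra.
Context {R : realType}.

Definition volterra (mu : set (I01 R) -> R) (f : I01 R -> R) (x : I01 R) :
    \bar R :=
  choquet mu [set t : I01 R | val t <= val x] f.

End volterra.

(* Main.v *)
(* The orbit of the constant function 1 is computed explicitly. If [F] is increasing and
   nonnegative, then [V F x] is the ordinary convolution of [F] with [exp (- t)], hence
   [V^n 1 = 1 - exp (- x) * sum_(k < n) x ^ k / k!]. Differences of consecutive iterates are
   the functions [exp (- x) * x ^ n / n!], so by the Weierstrass theorem, applied to
   [f x * exp x], the orbit spans a dense subspace of C[0, 1]; and C[0, 1] is dense in
   [L_(p, mu)] by truncation and Lusin's theorem. Since [mu] is submodular, the Choquet
   integral is subadditive, so [|V f x - V g x|] is at most the Choquet integral of
   [|f - g|]; this makes [V] well defined on classes and Lipschitz on both spaces. *)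
Require Import Defs.
From mathcomp Require Import all_boot all_order all_algebra.
From mathcomp Require Import all_classical all_reals all_analysis.
From mathcomp Require Import measurable_realfun.
From mathcomp Require Import ring lra.
Import Order.TTheory GRing.Theory Num.Theory numFieldNormedType.Exports.

Set Implicit Arguments.
Unset Strict Implicit.
Unset Printing Implicit Defensive.

Local Open Scope classical_set_scope.
Local Open Scope ring_scope.

(** The obstacle is the signed case: the Choquet integral has two half-line parts, and subadditivity
    is at hand only for nonnegative functions. Submodularity bounds both integrands by one even
    function of the level, [survival f], whose integral is twice that of [|f|]. The two parts then
    merge into the Lebesgue integral of a single kernel with an integrable majorant. For [V f x] the
    set function is the trace of [mu01] on the slice up to [x]. Traces are again monotone and
    submodular, and the majorant for [mu01] serves all [x] at once. This gives finiteness of [V f x]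
    and, by dominated convergence in the level, its continuity in [x], even when [f] is only
    measurable. Hence [V f] is continuous for every [f] in L_p, so it is bounded and lies in L_p
    again. The approximations in L_p use the same mechanism: dominated convergence in the level
    variable reduces them to smallness of [mu01] on each positive superlevel set. *)

Section lebesgue_isometry.
Context {R : realType}.
Local Notation leb := (@lebesgue_measure R).

(** The pushforward of the Lebesgue measure agrees with it on half-open intervals, so uniqueness of
    the measure identifies the two. Translations and the reflection of the level axis are the
    instances used. *)
Lemma integral_lebesgue_isometry (phi : measurableTypeR R -> measurableTypeR R)
    (D : set (measurableTypeR R)) (f : R -> \bar R) :
  measurable_fun setT phi ->
  (forall a b, leb (phi @^-1` `]a, b]) = leb `]a, b]%classic) ->
  measurable D -> measurable_fun D f -> {in D, forall y, (0 <= f y)%E} ->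
  (\int[leb]_(y in D) f y = \int[leb]_(x in phi @^-1` D) f (phi x))%E.
Proof.
move=> mphi phiI mD mf f0.
rewrite -[RHS](@ge0_integral_pushforward _ _ _ _ _ _ mphi leb D f)//.
apply: eq_measure_integral => A mA _.
pose nu : {measure set (measurableTypeR R) -> \bar R} := pushforward leb phi.
apply: (@lebesgue_measure_unique R (nu mphi)) => // X.
by move=> /ocitvP[->|[[a b] /= _ ->]]; rewrite ?measure0//; exact/esym/phiI.
Qed.

Lemma integral_lebesgue_shift (c : R) (D : set (measurableTypeR R)) (f : R -> \bar R) :
  measurable D -> measurable_fun D f -> {in D, forall y, (0 <= f y)%E} ->
  (\int[leb]_(y in D) f y = \int[leb]_(x in (+%R c) @^-1` D) f (c + x)%R)%E.
Proof.
apply: integral_lebesgue_isometry; first exact: measurable_funD.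
move=> a b; rewrite (_ : _ @^-1` _ = `]a - c, b - c]%classic); last first.
  by apply/seteqP; split=> x /=; rewrite !in_itv/= ltrBlDl lerBrDl.
rewrite !lebesgue_measure_itv/= !lte_fin ltrD2r.
by case: ifP => // _; rewrite -!EFinB; congr EFin; lra.
Qed.

Lemma integral_lebesgue_opp (D : set (measurableTypeR R)) (f : R -> \bar R) :
  measurable D -> measurable_fun D f -> {in D, forall y, (0 <= f y)%E} ->
  (\int[leb]_(y in D) f y = \int[leb]_(x in -%R @^-1` D) f (- x)%R)%E.
Proof.
apply: integral_lebesgue_isometry; first exact: oppr_measurable.
move=> a b; rewrite (_ : _ @^-1` _ = `[- b, - a[%classic); last first.
  by apply/seteqP; split=> x /=; rewrite !in_itv/= lerNl ltrNr andbC.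
rewrite !lebesgue_measure_itv/= !lte_fin ltrN2.
by case: ifP => // _; rewrite -!EFinB; congr EFin; lra.
Qed.

End lebesgue_isometry.

(** * Choquet integrals of signed functions: domination, subadditivity, convergence *)

Section choquet_estimates.
Context {R : realType} {T : Type}.
Variables (mu : set T -> R) (C : set (set T)).
Hypothesis mu0 : mu set0 = 0.
Hypothesis mu_mono : forall A B, A `<=` B -> mu A <= mu B.
Hypothesis CT : C setT.
Hypothesis CC : forall A, C A -> C (~` A).
Hypothesis CU : forall A B, C A -> C B -> C (A `|` B).
Hypothesis CI : forall A B, C A -> C B -> C (A `&` B).
Hypothesis mu_submod : forall A B, C A -> C B ->
  mu (A `|` B) + mu (A `&` B) <= mu A + mu B.
Local Notation leb := (@lebesgue_measure R).
Implicit Types f g : T -> R.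

Let mu_ge0 := monset_ge0 mu0 mu_mono.

Definition choquet_kernel f (b : R) : R :=
  mu [set w | b <= f w] - (if b < 0 then mu setT else 0).

(** Even in [b], so that one function dominates the kernel on both half-lines. *)
Definition survival f (b : R) : R := mu [set w | `|b| <= `|f w|].

Lemma measurable_choquet_kernel f :
  measurable_fun [set: measurableTypeR R] (choquet_kernel f : measurableTypeR R -> R).
Proof.
apply: measurable_funB; apply: nonincreasing_measurable => //.
- by move=> a b ab; exact: lev_le.
- move=> a b ab; case: (ltP b 0) => b0; first by rewrite (le_lt_trans ab b0).
  by case: ifP.
Qed.

Lemma survival_opp f b : survival f (- b) = survival f b.
Proof. by rewrite /survival normrN. Qed.

Lemma measurable_survival f :
  measurable_fun [set: measurableTypeR R] (survival f : measurableTypeR R -> R).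
Proof.
have m : measurable_fun [set: measurableTypeR R]
    ((fun b => mu [set w | b <= `|f w|]) : measurableTypeR R -> R).
  by apply: nonincreasing_measurable => // a b ab; exact: (lev_le mu_mono (fun w => `|f w|)).
exact: (measurableT_comp m (@normr_measurable R setT)).
Qed.

Lemma integrable_survival f : (layer mu (fun w => `|f w|)%R < +oo)%E ->
  leb.-integrable setT (EFin \o survival f).
Proof.
move=> fin; apply/integrableP; split.
  by apply/measurable_EFinP; exact: measurable_survival.
have E : (\int[leb]_(b in `[0%R, +oo[) (survival f b)%:E)%E = layer mu (fun w => `|f w|).
  rewrite /layer; apply: eq_integral => b; rewrite inE/= in_itv/= andbT => b0.
  by rewrite /survival ger0_norm.
under eq_integral => b _ do rewrite /= ger0_norm ?mu_ge0//.
have U : [set: measurableTypeR R] = `[0%R, +oo[ `|` `]-oo, 0%R[.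
  by apply/seteqP; split=> // b _ /=; rewrite !in_itv/= andbT; case: (leP 0 b); [left|right].
rewrite U ge0_integral_setU//=; last 3 first.
- by apply: measurable_funTS; apply/measurable_EFinP; exact: measurable_survival.
- by move=> b _; rewrite lee_fin mu_ge0.
- apply/disj_setPS => b [] /=; rewrite !in_itv/= andbT => b0 b1.
  by have := le_lt_trans b0 b1; rewrite ltxx.
rewrite E lte_add_pinfty//.
rewrite integral_itv_bndo_bndc; last first.
  by apply: measurable_funTS; apply/measurable_EFinP; exact: measurable_survival.
rewrite integral_lebesgue_opp//; last 2 first.
- by apply: measurable_funTS; apply/measurable_EFinP; exact: measurable_survival.
- by move=> b _; rewrite lee_fin mu_ge0.
rewrite (_ : _ @^-1` _ = `[0%R, +oo[%classic); last first.
  by apply/seteqP; split=> b /=; rewrite !in_itv/= andbT oppr_le0.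
by under eq_integral do rewrite survival_opp; rewrite E.
Qed.

(** The case [b < 0] is the essential one: submodularity, applied to a superlevel set and its
    complement, bounds the missing mass by [mu] of the set where [f < b], and there [|f|] exceeds
    [|b|]. *)
Lemma choquet_kernel_survival f b : clev C f -> `|choquet_kernel f b| <= survival f b.
Proof.
move=> Cf; rewrite /choquet_kernel /survival; case: ltP => b0; last first.
  rewrite subr0 ger0_norm ?mu_ge0//; apply: mu_mono => w /= bf.
  by rewrite (ger0_norm b0) (le_trans bf)// ler_norm.
rewrite distrC ger0_norm ?subr_ge0; last exact: mu_mono.
rewrite lerBlDr; apply: (@le_trans _ _ (mu (~` [set w | b <= f w]) + mu [set w | b <= f w])).
  have := mu_submod (CC (Cf b)) (Cf b).
  by rewrite setUC setUv setIC setICr mu0 addr0.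
rewrite lerD2r; apply: mu_mono => w /= /negP; rewrite -ltNge => fb.
by rewrite !ltr0_norm ?lerN2 ?(ltW fb)// (lt_trans fb b0).
Qed.

Lemma integrable_choquet_kernel f : clev C f ->
  (layer mu (fun w => `|f w|)%R < +oo)%E -> leb.-integrable setT (EFin \o choquet_kernel f).
Proof.
move=> Cf fin; apply: (le_integrable _ _ _ (integrable_survival fin)) => //.
  by apply/measurable_EFinP; exact: measurable_choquet_kernel.
by move=> b _ /=; rewrite lee_fin [leRHS]ger0_norm ?mu_ge0// choquet_kernel_survival.
Qed.

Lemma choquet_kernelE f :
  choquet mu setT f = (\int[leb]_b (choquet_kernel f b)%:E)%E.
Proof.
have U : [set: measurableTypeR R] = `[0%R, +oo[ `|` `]-oo, 0%R[.
  by apply/seteqP; split=> // b _ /=; rewrite !in_itv/= andbT; case: (leP 0 b); [left|right].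
rewrite U integral_setU_EFin//=; last 2 first.
- by apply: measurable_funTS; exact: measurable_choquet_kernel.
- apply/disj_setPS => b [] /=; rewrite !in_itv/= andbT => b0 b1.
  by have := le_lt_trans b0 b1; rewrite ltxx.
rewrite /choquet; congr (_ + _)%E.
  apply: eq_integral => b; rewrite inE/= in_itv/= andbT => b0.
  by rewrite /choquet_kernel ltNge b0/= subr0 setTI.
(* The kernel subtracts [mu setT] only for [b < 0], the Choquet integral also at [b = 0]; the single
   level is null. *)
rewrite -integral_itv_bndo_bndc; last first.
  apply: measurable_funTS; apply/measurable_EFinP.
  apply: nonincreasing_measurable => // a b ab.
  by rewrite !setTI lerD2r lev_le.
apply: eq_integral => b; rewrite inE/= in_itv/= => b0.
by rewrite /choquet_kernel b0 setTI.
Qed.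

Lemma choquet_fin_num f : clev C f -> (layer mu (fun w => `|f w|)%R < +oo)%E ->
  choquet mu setT f \is a fin_num.
Proof.
move=> Cf fin; rewrite choquet_kernelE.
exact/integrable_fin_num/integrable_choquet_kernel.
Qed.

(** Truncation at [- M] changes no superlevel set above that level, and adding [M] translates the
    levels. The interval is open because at the level [- M] itself the truncated function has a full
    superlevel set. *)
Lemma layer_shift f (M : R) :
  layer mu (fun w => M + Num.max (f w) (- M)) =
  (\int[leb]_(b in `](- M)%R, +oo[) (mu [set w | (b <= f w)%R])%:E)%E.
Proof.
rewrite /layer -integral_itv_obnd_cbnd; last first.
  exact: lev_measurable.
rewrite (integral_lebesgue_shift M)//; last 2 first.
- exact: lev_measurable.
- by move=> b _; rewrite lee_fin mu_ge0.
rewrite (_ : _ @^-1` _ = `](- M)%R, +oo[%classic); last first.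
  by apply/seteqP; split=> b /=; rewrite !in_itv/= !andbT -ltrBlDl sub0r.
apply: eq_integral => b; rewrite inE/= in_itv/= andbT => Mb.
congr (EFin (mu _)); apply/seteqP; split=> w /=.
  by rewrite lerD2l le_max => /orP[//|/(lt_le_trans Mb)]; rewrite ltxx.
by rewrite lerD2l le_max => ->.
Qed.

Lemma layer_cst_le (M : R) : 0 <= M -> (layer mu (fun=> M) <= (M * mu setT)%:E)%E.
Proof.
move=> M0; apply: (@le_epsE _ _ _ (mu setT)) => // e e0.
(* With step [M + e] every sampled level exceeds the constant, so the Riemann sum vanishes and only
   the first slab counts. *)
rewrite -EFinD -mulrDl -[_ * _]addr0; apply: layer_le_rsum => //.
  by rewrite ltr_wpDl.
move=> K; rewrite /rsum big1 ?mulr0// => k _; rewrite -[RHS]mu0; congr mu.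
apply/seteqP; split=> // w /=; apply/negP; rewrite -ltNge.
by rewrite (@lt_le_trans _ _ (M + e)) ?ltrDl// ler_peMl ?ler1n// addr_ge0// ltW.
Qed.

(** On the levels between [- n] and [0] the survival function of the constant [n] equals [mu setT],
    which makes it an integrable majorant. *)
Lemma integrable_level_cst (n : R) : 0 <= n ->
  leb.-integrable `](- n)%R, +oo[ (fun b : R => (if (b < 0)%R then mu setT else 0%R)%:E).
Proof.
move=> n0; have cfin : (layer mu (fun=> `|n|)%R < +oo)%E.
  by apply: le_lt_trans (layer_cst_le (normr_ge0 _)) _; exact: ltry.
have /integrableS ic := integrable_survival cfin.
have {ic} := ic `](- n)%R, +oo[%classic measurableT (measurable_itv _) (@subsetT _ _).
apply: le_integrable => //.
  apply: measurable_funTS; apply/measurable_EFinP.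
  apply: nonincreasing_measurable => // a b ab; case: (ltP b 0) => b0.
    by rewrite (le_lt_trans ab b0).
  by case: ifP.
move=> b /=; rewrite in_itv/= andbT => nb.
rewrite lee_fin (ger0_norm (mu_ge0 _)); case: ifP => b0; last by rewrite normr0.
rewrite ger0_norm//; apply: mu_mono => w _ /=; rewrite (ger0_norm n0).
by rewrite ltr0_norm// lerNl ltW.
Qed.

(** The last integral is finite and does not depend on [f], so it cancels when two functions are
    compared. *)
Lemma integral_level_kernel f (n : R) : 0 <= n -> clev C f ->
  (layer mu (fun w => `|f w|)%R < +oo)%E ->
  (\int[leb]_(b in `](- n)%R, +oo[) (mu [set w | (b <= f w)%R])%:E =
   \int[leb]_(b in `](- n)%R, +oo[) (choquet_kernel f b)%:E +
   \int[leb]_(b in `](- n)%R, +oo[) (if (b < 0)%R then mu setT else 0%R)%:E)%E.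
Proof.
move=> n0 Cf fin; rewrite -integralD//.
- by apply: eq_integral => b _; rewrite -EFinD /choquet_kernel subrK.
- by apply: integrableS (integrable_choquet_kernel Cf fin).
- exact: integrable_level_cst.
Qed.

Lemma cvg_integral_choquet_kernel f : clev C f ->
  (layer mu (fun w => `|f w|)%R < +oo)%E ->
  (\int[leb]_(b in `](- n%:R)%R, +oo[) (choquet_kernel f b)%:E)%E
    @[n --> \oo] --> choquet mu setT f.
Proof.
move=> Cf fin; rewrite choquet_kernelE; under eq_fun do rewrite integral_mkcond.
apply: (@dominated_cvg _ _ _ leb _ _ _ _ (EFin \o survival f)) => //.
- move=> n; apply/(measurable_restrictT _ _).1 => //.
  by apply: measurable_funTS; apply/measurable_EFinP; exact: measurable_choquet_kernel.
- move=> b _; apply: cvg_near_cst; near=> n.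
  rewrite patchE ifT// inE/= in_itv/= andbT ltrNl.
  by near: n; exact: nbhs_infty_gtr.
- exact: integrable_survival.
- move=> n b _; rewrite patchE; case: ifP => _; rewrite lee_fin.
    exact: choquet_kernel_survival.
  by rewrite normr0 mu_ge0.
Unshelve. all: by end_near. Qed.

(* Truncating below at [-n] and translating by [n] reduces the claim to the
   subadditivity of [layer] on nonnegative functions; then [n] tends to infinity. *)
Lemma le_choquetD f g h : clev C f -> clev C g -> clev C h ->
  (forall t, 0 <= h t) -> (forall t, f t <= g t + h t) ->
  (layer mu (fun w => `|f w|)%R < +oo)%E -> (layer mu (fun w => `|g w|)%R < +oo)%E ->
  (choquet mu setT f <= choquet mu setT g + layer mu h)%E.
Proof.
move=> Cf Cg Ch h0 fgh ff fg.
have gfin := choquet_fin_num Cg fg.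
have [->|hfin] := eqVneq (layer mu h) +oo%E; first by rewrite addey ?leey//; case: choquet gfin.
have {}hfin : layer mu h \is a fin_num.
  by rewrite ge0_fin_numE ?layer_ge0// ltey.
have cf := cvg_integral_choquet_kernel Cf ff.
have cg : (\int[leb]_(b in `](- n%:R)%R, +oo[) (choquet_kernel g b)%:E + layer mu h)%E
    @[n --> \oo] --> (choquet mu setT g + layer mu h)%E.
  apply: cvgeD; [|exact: cvg_integral_choquet_kernel|exact: cvg_cst].
  exact: fin_num_adde_defl.
rewrite -(cvg_lim _ cf)// -(cvg_lim _ cg)//; apply: lee_lim.
- exact: cvgP cf.
- exact: cvgP cg.
apply: nearW => n; have n0 : 0 <= n%:R :> R by [].
have cfin : (\int[leb]_(b in `](- n%:R)%R, +oo[)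
    (if (b < 0)%R then mu setT else 0%R)%:E)%E \is a fin_num.
  by apply: integrable_fin_num => //; exact: integrable_level_cst.
rewrite -(leeD2rE _ _ cfin) -integral_level_kernel// addeAC -integral_level_kernel//.
rewrite -!layer_shift.
have Cv : clev C (fun w => n%:R + Num.max (g w) (- n%:R)).
  move=> a; have [a0|a0] := leP a 0.
    rewrite (_ : [set w | _] = setT)//; apply/seteqP; split=> // w _ /=.
    by rewrite (le_trans a0)// -lerBlDl sub0r le_max lexx orbT.
  rewrite (_ : [set w | _] = [set w | a - n%:R <= g w])//.
  apply/seteqP; split=> w /=; rewrite -lerBlDl le_max.
    by move=> /orP[//|]; rewrite lerBlDl subrr leNgt a0.
  by move=> ->.
apply: le_trans (layer_add mu0 mu_mono CU CI mu_submod _ h0 Cv Ch); last first.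
  by move=> t; rewrite -lerBlDl sub0r le_max lexx orbT.
apply: le_layer => // t; rewrite -addrA lerD2l ge_max.
have : g t <= Num.max (g t) (- n%:R) by rewrite le_max lexx.
have : - n%:R <= Num.max (g t) (- n%:R) by rewrite le_max lexx orbT.
have := fgh t; have := h0 t; move: (Num.max _ _) => m.
by move=> h1 h2 h3 h4; apply/andP; split; lra.
Qed.

(** Although [mu] is not additive, its layer integral is a Lebesgue integral in the level, so
    ordinary dominated convergence applies. The level [0], where superlevel sets need not shrink, is
    removed as a null set. *)
Lemma cvg_layer0 (u_ : (T -> R)^nat) (v : T -> R) :
  (forall n t, u_ n t <= v t) -> (layer mu v < +oo)%E ->
  (forall b, 0 < b -> mu [set w | b <= u_ n w] @[n --> \oo] --> 0) ->
  layer mu (u_ n) @[n --> \oo] --> 0%E.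
Proof.
move=> uv vfin u0; rewrite /layer.
have E w : (\int[leb]_(b in `[0%R, +oo[) (mu [set t | (b <= w t)%R])%:E =
            \int[leb]_(b in `]0%R, +oo[) (mu [set t | (b <= w t)%R])%:E)%E.
  by rewrite integral_itv_obnd_cbnd//; exact: lev_measurable.
under eq_fun do rewrite E.
have -> : 0%E = (\int[leb]_(b in `]0%R, +oo[) (cst 0%E b))%E :> \bar R by rewrite integral0.
apply: (@dominated_cvg _ _ _ leb `]0%R, +oo[%classic _
  (fun n b => (mu [set w | (b <= u_ n w)%R])%:E) (cst 0%E)
  (fun b => (mu [set w | (b <= v w)%R])%:E)) => //.
- by move=> n; exact: lev_measurable.
- by move=> b /=; rewrite in_itv/= andbT => b0; apply: cvg_EFin; [exact: nearW|exact: u0].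
- apply/integrableP; split; first exact: lev_measurable.
  under eq_integral do rewrite gee0_abs ?lee_fin ?mu_ge0//.
  by rewrite -E.
- move=> n b _; rewrite gee0_abs ?lee_fin ?mu_ge0//; apply: mu_mono => w /= h.
  exact: le_trans (uv n w).
Qed.

End choquet_estimates.

Lemma choquet_restrict {R : realType} {T : Type} (mu : set T -> R) (A : set T) (f : T -> R) :
  choquet mu A f = choquet (fun B => mu (A `&` B)) setT f.
Proof.
rewrite /choquet setIT; congr (_ + _)%E;
  by apply: eq_integral => b _; rewrite setTI.
Qed.

(** * The function [V f]: finiteness, stability in [f], continuity in [x] *)

Section volterra_choquet.
Context {R : realType}.
Local Notation leb := (@lebesgue_measure R).

Definition slice (x : R) : set (I01 R) := [set t | val t <= x].

Definition mu_slice (x : R) (B : set (I01 R)) : R := mu01 (slice x `&` B).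

Lemma mu_slice0 x : mu_slice x set0 = 0.
Proof. by rewrite /mu_slice setI0 mu01_0. Qed.

Lemma mu_slice_mono x A B : A `<=` B -> mu_slice x A <= mu_slice x B.
Proof. by move=> AB; apply: mu01_mono; exact: setIS. Qed.

Lemma mu_slice_le x A : mu_slice x A <= mu01 A.
Proof. by apply: mu01_mono; exact: subIsetr. Qed.

Lemma leb01_slice_le x y B : x <= y ->
  leb01 (slice y `&` B) <= leb01 (slice x `&` B) + (y - x).
Proof.
move=> xy; rewrite /leb01.
have lxy : leb `]x, y]%classic = (y - x)%:E.
  rewrite lebesgue_measure_itv/= lte_fin.
  by move: xy; rewrite le_eqVlt => /predU1P[->|->]; [rewrite ltxx subrr|rewrite EFinB].
rewrite -lee_fin EFinD !fineK ?leb_fin// -lxy.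
apply: le_trans (outer_measureU2 ((wlength (@idfun R))^*)%mu _ _).
apply: leb_mono => _ [t [/= ty Bt] <-]; case: (leP (val t) x) => tx; [left|right].
  by exists t.
by rewrite /= in_itv/= tx.
Qed.

(** Moving the endpoint from [x] to [y] adds at most the strip between them, so the dependence is
    Lipschitz with constant 1. *)
Lemma leb01_slice_continuous B : continuous (fun x => leb01 (slice x `&` B)).
Proof.
have lip x y : `|leb01 (slice x `&` B) - leb01 (slice y `&` B)| <= `|x - y|.
  wlog xy : x y / x <= y.
    by move=> H; have [/H//|/ltW/H] := leP x y; rewrite distrC [leRHS]distrC.
  have m : leb01 (slice x `&` B) <= leb01 (slice y `&` B).
    by apply: leb01_mono; apply: setSI => t /= /le_trans; apply.
  rewrite distrC [leRHS]distrC !ger0_norm ?subr_ge0//.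
  by have := leb01_slice_le B xy; lra.
move=> x; apply/cvgrPdist_lt => e e0; near=> y.
apply: le_lt_trans (lip _ _) _.
by near: y; exact: cvgr_dist_lt.
Unshelve. all: by end_near. Qed.

Lemma distortion_continuous : continuous (@distortion R).
Proof.
move=> x; rewrite /distortion; apply: cvgB; first exact: cvg_cst.
by apply: (@cvg_comp _ _ _ -%R expR _ (nbhs (- x))); [exact: cvgN|exact: continuous_expR].
Qed.

Lemma mu_slice_continuous B : continuous (mu_slice ^~ B).
Proof.
move=> x; apply: (@cvg_comp _ _ _ (fun y => leb01 (slice y `&` B)) distortion).
  exact: leb01_slice_continuous.
exact: distortion_continuous.
Qed.

Variable c : sigma_alg.
Implicit Types (f g : I01 R -> R) (A B : set (I01 R)).

Lemma csetsT : csets c [set: I01 R]. Proof. by rewrite -setC0; exact/csetsC/csets0. Qed.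

Lemma csetsU A B : csets c A -> csets c B -> csets c (A `|` B).
Proof. exact: (@measurableU _ (I01c R c)). Qed.

Lemma csetsI A B : csets c A -> csets c B -> csets c (A `&` B).
Proof. exact: (@measurableI _ (I01c R c)). Qed.

Lemma csets_slice x : csets c (slice x).
Proof.
rewrite csetsE; apply: rsets_borel.
rewrite (_ : _ @` _ = `[0, 1] `&` `]-oo, x]); first exact: measurableI.
apply/seteqP; split=> y /=.
  by move=> [t tx <-]; split; [exact: (set_valP t)|rewrite in_itv].
by rewrite in_itv/= => -[yI yx]; exists (exist _ y (mem_set yI)).
Qed.

Lemma mu_slice_submod x A B : csets c A -> csets c B ->
  mu_slice x (A `|` B) + mu_slice x (A `&` B) <= mu_slice x A + mu_slice x B.
Proof.
move=> cA cB; rewrite /mu_slice setIUr setIIr.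
by apply: (@mu01_submod _ c); apply: csetsI => //; exact: csets_slice.
Qed.

Lemma measurable_clev f :
  measurable_fun [set: I01c R c] (f : I01c R c -> R) -> clev (csets c) f.
Proof.
move=> mf a; have := mf measurableT `[a, +oo[%classic (measurable_itv _).
by rewrite setTI; congr (csets c _); apply/seteqP; split=> t /=; rewrite in_itv/= andbT.
Qed.

Lemma choquet_slice x f : choquet mu01 (slice x) f = choquet (mu_slice x) setT f.
Proof. exact: choquet_restrict. Qed.

Lemma layer_slice_le x f : (layer (mu_slice x) f <= layer mu01 f)%E.
Proof.
apply: ge0_le_integral => //.
- by move=> b _; rewrite lee_fin (monset_ge0 (mu_slice0 x) (@mu_slice_mono x)).
- by apply: lev_measurable => // A B; exact: mu_slice_mono.
- by apply: lev_measurable => // A B; exact: mu01_mono.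
- by move=> b _; rewrite lee_fin; exact: mu_slice_le.
Qed.

(* This class contains both C[0, 1] and all the spaces [L_p]. *)
Definition integrable01 f := measurable_fun [set: I01c R c] (f : I01c R c -> R) /\
  (layer mu01 (fun t => `|f t|)%R < +oo)%E.

Lemma integrable01_slice x f : integrable01 f ->
  (layer (mu_slice x) (fun t => `|f t|)%R < +oo)%E.
Proof. by move=> [_]; apply: le_lt_trans; exact: layer_slice_le. Qed.

Definition volterra_fun f (x : R) : R := fine (choquet mu01 (slice x) f).

Lemma volterra_funE f x : integrable01 f ->
  (volterra_fun f x)%:E = choquet mu01 (slice x) f.
Proof.
move=> intf; rewrite /volterra_fun fineK// choquet_slice.
apply: (@choquet_fin_num _ _ _ (csets c)).
- exact: mu_slice0.
- exact: mu_slice_mono.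
- exact: csetsC.
- exact: mu_slice_submod.
- by apply: measurable_clev; case: intf.
- exact: integrable01_slice.
Qed.

Lemma volterra_fun_dist f g x (d : R) : integrable01 f -> integrable01 g ->
  (layer mu01 (fun t => `|f t - g t|)%R <= d%:E)%E ->
  `|volterra_fun f x - volterra_fun g x| <= d.
Proof.
wlog suff : f g / integrable01 f -> integrable01 g ->
    (layer mu01 (fun t => `|f t - g t|)%R <= d%:E)%E ->
    volterra_fun f x - volterra_fun g x <= d.
  move=> H intf intg fgd; have gfd : (layer mu01 (fun t => `|g t - f t|)%R <= d%:E)%E.
    have -> : (fun t => `|g t - f t|) = (fun t => `|f t - g t|).
      by apply/funext => t; rewrite distrC.
    exact: fgd.
  rewrite ler_norml (H f g intf intg fgd) andbT lerNl opprB.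
  exact: H g f intg intf gfd.
move=> intf intg fgd; rewrite lerBlDl -lee_fin EFinD.
have Ef := volterra_funE x intf; have Eg := volterra_funE x intg.
rewrite [X in (X <= _)%E]Ef Eg.
have mfg : measurable_fun [set: I01c R c] ((fun t => `|f t - g t|) : I01c R c -> R).
  apply: measurableT_comp => //; case: intf => mf _; case: intg => mg _.
  exact: measurable_funB.
rewrite !choquet_slice.
apply: (@le_trans _ _ (choquet (mu_slice x) setT g
                       + layer (mu_slice x) (fun t => `|f t - g t|)%R)%E); last first.
  by apply: leeD2l; exact: le_trans (layer_slice_le x _) fgd.
apply: (@le_choquetD _ _ _ (csets c)).
- exact: mu_slice0.
- exact: mu_slice_mono.
- exact: csetsT.
- exact: csetsC.
- exact: csetsU.
- exact: csetsI.
- exact: mu_slice_submod.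
- by apply: measurable_clev; case: intf.
- by apply: measurable_clev; case: intg.
- exact: measurable_clev.
- by [].
- by move=> t; rewrite -lerBlDl ler_norm.
- exact: integrable01_slice.
- exact: integrable01_slice.
Qed.

(** At a fixed level the kernel of [mu_slice x] is continuous in [x], and [survival mu01 f]
    dominates it for all [x]. The open interval from -1 to 2 is a convenient neighbourhood of the
    unit interval, whose endpoints are thereby covered. *)
Lemma volterra_fun_continuous f : integrable01 f ->
  {in `](-1)%R, 2%R[%classic, continuous (volterra_fun f)}.
Proof.
move=> intf; have [mf finf] := intf.
have mu_ge0 := monset_ge0 (@mu01_0 R) (@mu01_mono R).
have -> : volterra_fun f = fun x => \int[leb]_(b in setT) (choquet_kernel (mu_slice x) f b).
  apply/funext => x; rewrite /volterra_fun choquet_slice choquet_kernelE//.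
    exact: mu_slice0.
  exact: mu_slice_mono.
apply: (@continuity_under_integral R _ _ leb (fun x => choquet_kernel (mu_slice x) f)
  setT measurableT (-1) 2 _ _ (survival mu01 f)).
- move=> x _; apply: (@integrable_choquet_kernel _ _ _ (csets c)).
  + exact: mu_slice0.
  + exact: mu_slice_mono.
  + exact: csetsC.
  + exact: mu_slice_submod.
  + exact: measurable_clev.
  + exact: integrable01_slice.
- apply: aeW => b _ x _; rewrite /choquet_kernel; apply: cvgB.
    exact: mu_slice_continuous.
  by case: ifP => _; [exact: mu_slice_continuous|exact: cvg_cst].
- apply: integrable_survival => //; [exact: mu01_0|exact: mu01_mono].
- move=> x _; apply: aeW => b _.
  apply: (@le_trans _ _ (survival (mu_slice x) f b)); last exact: mu_slice_le.
  apply: (@choquet_kernel_survival _ _ _ (csets c)).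
  + exact: mu_slice0.
  + exact: mu_slice_mono.
  + exact: csetsC.
  + exact: mu_slice_submod.
  + exact: measurable_clev.
Qed.

End volterra_choquet.

(** * Calculus of the orbit functions *)

Section volterra_iterates.
Context {R : realType}.
Local Notation leb := (@lebesgue_measure R).

(** The Poisson weights of parameter [x]; as a function of [x >= 0], the density of the Gamma law of
    shape [n.+1]. Accordingly [exp_tail] is the Poisson tail, and [exp_tail n.+1] the Gamma
    distribution function. *)
Definition exp_term (n : nat) (x : R) : R := expR (- x) * (x ^+ n / n`!%:R).

Definition exp_tail (n : nat) (x : R) : R := 1 - \sum_(k < n) exp_term k x.

Lemma exp_tailS n x : exp_tail n.+1 x = exp_tail n x - exp_term n x.
Proof. by rewrite /exp_tail big_ord_recr/= opprD addrA. Qed.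

Lemma exp_tail0 x : exp_tail 0 x = 1. Proof. by rewrite /exp_tail big_ord0 subr0. Qed.

Lemma exp_tail1 x : exp_tail 1 x = 1 - expR (- x).
Proof. by rewrite exp_tailS exp_tail0 /exp_term expr0 fact0 divr1 mulr1. Qed.

Lemma exp_term_gt0 n x : 0 < x -> 0 < exp_term n x.
Proof. by move=> x0; rewrite mulr_gt0 ?expR_gt0// divr_gt0 ?exprn_gt0// ltr0n fact_gt0. Qed.

Lemma is_derive_exp_term (n : nat) (x : R) :
  is_derive x (1 : R) (exp_term n) ((if n is m.+1 then exp_term m x else 0) - exp_term n x).
Proof.
(* Written with function-level operations, so that derivatives are found by instance resolution. *)
pose q : R -> R := n`!%:R^-1 *: (id ^+ n).
have -> : exp_term n = (expR \o -%R) * q.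
  by apply/funext => y; rewrite /exp_term [(_ / _)%R in LHS]mulrC /q exprfctE.
have fE : (n`!%:R : R) != 0 by rewrite pnatr_eq0 -lt0n fact_gt0.
rewrite /q; apply: is_derive_eq; rewrite -/q [RHS]addrC -[((_ \o _) * q) x]/(expR (- x) * q x).
rewrite /GRing.scale/= mulrN1 mulr1 mulrN [RHS]addrC mulrC [q x * _]mulrC; congr (_ - _).
rewrite mulrC; case: n q fE => [|n] q fE; first by rewrite mul0r mulr0 mulr0.
rewrite /exp_term; congr (_ * _); rewrite factS natrM in fE *.
by rewrite /=; move: fE; rewrite mulf_eq0 negb_or => /andP[? ?]; field; apply/andP.
Qed.

Lemma exp_term_continuous n : continuous (exp_term n).
Proof.
by move=> x; apply/differentiable_continuous/derivable1_diffP; case: (is_derive_exp_term n x).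
Qed.

(** The derivative of each weight is the preceding weight minus itself, so the sum telescopes. *)
Lemma is_derive_exp_tail (n : nat) (x : R) :
  is_derive x (1 : R) (exp_tail n.+1) (exp_term n x).
Proof.
elim: n => [|n IH].
  have -> : exp_tail 1 = cst 1 - exp_term 0.
    by apply/funext => y; rewrite exp_tailS exp_tail0.
  have ? := is_derive_exp_term 0 x.
  by apply: is_derive_eq; rewrite /= !sub0r opprK.
have -> : exp_tail n.+2 = exp_tail n.+1 - exp_term n.+1.
  by apply/funext => y; rewrite exp_tailS.
have ? := is_derive_exp_term n.+1 x.
by apply: is_derive_eq; rewrite /= opprB addrC subrK.
Qed.

Lemma derive1_exp_tail n : (exp_tail n.+1)^`()%classic = exp_term n.
Proof.
by apply/funext => x; rewrite derive1E; have ? := is_derive_exp_tail n x; rewrite derive_val.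
Qed.

Lemma exp_tail_continuous n : continuous (exp_tail n).
Proof.
case: n => [|n] x; last first.
  by apply/differentiable_continuous/derivable1_diffP; case: (is_derive_exp_tail n x).
have -> : exp_tail 0 = cst 1 by apply/funext => y; rewrite exp_tail0.
exact: cst_continuous.
Qed.

Lemma exp_tail_at0 n : exp_tail n.+1 0 = 0.
Proof.
elim: n => [|n IH]; first by rewrite exp_tail1 oppr0 expR0 subrr.
by rewrite exp_tailS IH /exp_term expr0n/= mul0r mulr0 subrr.
Qed.

(** Strictness provides the inverse function that describes the superlevel sets; it fails for
    [exp_tail 0], which is constant. *)
Lemma exp_tail_lt n (x y : R) : 0 <= x -> x < y -> exp_tail n.+1 x < exp_tail n.+1 y.
Proof.
move=> x0 xy; apply: (@gtr0_derive1_lt_cc R (exp_tail n.+1) 0 y) => //.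
- by move=> z _; case: (is_derive_exp_tail n z).
- move=> z; rewrite in_itv/= => /andP[z0 _].
  by rewrite derive1_exp_tail exp_term_gt0.
- exact/continuous_subspaceT/exp_tail_continuous.
- by rewrite in_itv/= x0 ltW.
- by rewrite in_itv/= lexx (le_trans x0 (ltW xy)).
Qed.

Lemma exp_tail_le n (x y : R) : 0 <= x -> x <= y -> exp_tail n x <= exp_tail n y.
Proof.
case: n => [|n] x0; first by rewrite !exp_tail0.
by rewrite le_eqVlt => /predU1P[->//|/(exp_tail_lt n x0)/ltW].
Qed.

Lemma exp_tail_ge0 n (x : R) : 0 <= x -> 0 <= exp_tail n x.
Proof.
move=> x0; apply: le_trans (exp_tail_le n (lexx 0) x0).
by case: n => [|n]; rewrite ?exp_tail0// exp_tail_at0.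
Qed.

End volterra_iterates.

(** * One step of the orbit *)

Section volterra_exp_tail.
Context {R : realType}.
Local Notation leb := (@lebesgue_measure R).

Lemma mu_slice_tail (x s : R) (B : set (I01 R)) : 0 <= s -> s <= x -> x <= 1 ->
  slice x `&` B = [set t : I01 R | s <= val t <= x] ->
  mu_slice x B = distortion (x - s).
Proof.
move=> s0 sx x1 E; rewrite /mu_slice /mu01 /leb01 E.
rewrite (_ : _ @` _ = `[s, x]%classic); last first.
  apply/seteqP; split=> y /=.
    by move=> [t /andP[st tx] <-]; rewrite in_itv/= st.
  rewrite in_itv/= => /andP[sy yx].
  have yI : I01 R y by rewrite /I01/= in_itv/= (le_trans s0 sy) (le_trans yx x1).
  by exists (exist _ y (mem_set yI)); rewrite //= sy.
rewrite lebesgue_measure_itv/= lte_fin; move: sx; rewrite le_eqVlt => /predU1P[->|->].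
  by rewrite ltxx subrr.
by rewrite -EFinB.
Qed.

(** Treated apart because a constant has no inverse function. The layer is bounded above by
    [layer_cst_le] and below by a single slab of height 1. *)
Lemma volterra_fun_cst1 (x : R) : 0 <= x <= 1 ->
  volterra_fun (fun=> 1) x = 1 - expR (- x).
Proof.
move=> /andP[x0 x1]; rewrite /volterra_fun choquet_slice choquet_ge0E//.
have mT : mu_slice x setT = 1 - expR (- x).
  rewrite (@mu_slice_tail x 0)// ?subr0// setIT.
  apply/seteqP; split=> t /=; last by case/andP.
  by move=> ->; have := set_valP t; rewrite /I01/= in_itv/= => /andP[->].
rewrite -mT; suff -> : layer (mu_slice x) (fun=> 1) = (mu_slice x setT)%:E by [].
apply/eqP; rewrite eq_le; apply/andP; split.
  rewrite -[X in (_ <= X%:E)%E]mul1r; apply: layer_cst_le => //.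
    exact: mu_slice0.
  exact: mu_slice_mono.
have := @rsum_le_layer _ _ _ (mu_slice0 x) (@mu_slice_mono _ x) (fun=> 1) _ 1 ltr01.
rewrite /rsum big_ord_recl big_ord0 addr0 mul1r; apply: le_trans.
by rewrite lee_fin; apply: mu_slice_mono => w _ /=; rewrite mulr1.
Qed.

(* The superlevel set of an increasing function is an interval [g b, x] where [g] is the
   inverse function, hence [V F x] is the integral of [1 - exp (- (x - g b))] over
   [0 <= b <= F x]; then substitute [b = F t]. *)
Lemma volterra_fun_exp_tail n (x : R) : 0 <= x <= 1 ->
  volterra_fun (exp_tail n \o val) x = exp_tail n.+1 x.
Proof.
case: n => [|n] x01.
  have -> : exp_tail 0 \o val = (fun=> 1) :> (I01 R -> R).
    by apply/funext => t /=; rewrite exp_tail0.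
  by rewrite volterra_fun_cst1// exp_tail1.
have /andP[x0 x1] := x01.
set F := exp_tail n.+1.
have I0 (t : I01 R) : 0 <= val t.
  by have := set_valP t; rewrite /I01/= in_itv/= => /andP[].
have F0 (t : I01 R) : 0 <= (F \o val) t by apply: exp_tail_ge0; exact: I0.
have FF : F 0 = 0 by exact: exp_tail_at0.
rewrite /volterra_fun choquet_slice choquet_ge0E// /layer.
(* The fundamental theorem of calculus, used at the end, needs a nondegenerate interval; at [x = 0]
   the slice is null. *)
move: x0; rewrite le_eqVlt => /predU1P[x0|x0].
  rewrite -x0 exp_tail_at0 integral0_eq// => b _; congr EFin.
  rewrite /mu_slice; apply/eqP; rewrite eq_le (monset_ge0 (@mu01_0 R) (@mu01_mono R)) andbT.
  apply: le_trans (mu_slice_mono _ (@subsetT _ _)) _.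
  rewrite (@mu_slice_tail 0 0) ?subrr ?ler01 ?lexx//.
    by rewrite /distortion oppr0 expR0 subrr.
  rewrite setIT; apply/seteqP; split=> t /=; last by case/andP.
  by move=> ->; rewrite I0.
have Fcont a b : {within `[a, b], continuous F}.
  exact/continuous_subspaceT/exp_tail_continuous.
have Fmono (s t : R) : 0 <= s -> 0 <= t -> (F s <= F t) = (s <= t).
  move=> s0 t0; have [st|ts] := leP s t; first exact: exp_tail_le.
  by apply/negbTE; rewrite -ltNge exp_tail_lt.
have Fx0 : 0 <= F x by apply: exp_tail_ge0; exact: ltW.
(* The default value 0 is never relied on: only levels between [0] and [F x] matter, and there [gP]
   applies. *)
pose g b : R := xget 0 [set t | 0 <= t <= x /\ F t = b].
have gP b : 0 <= b <= F x -> 0 <= g b <= x /\ F (g b) = b.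
  move=> bF; rewrite /g; case: xgetP => [t _ //|none].
  have [|t] := @IVT R F 0 x b (ltW x0) (Fcont _ _).
    by rewrite FF (min_idPl Fx0) (max_idPr Fx0).
  by rewrite in_itv/= => tI Ft; have := none t; case.
have FK : {in `[0, x], cancel F g}.
  move=> t; rewrite in_itv/= => /andP[t0 tx].
  have [] := gP (F t); first by rewrite exp_tail_ge0// exp_tail_le.
  move=> /andP[g0 gx] Fg; apply: le_anti.
  by rewrite -(Fmono _ _ g0 t0) -(Fmono _ _ t0 g0) Fg lexx.
pose G b : R := distortion (x - g b).
have lay : (\int[leb]_(b in `[0%R, +oo[) (mu_slice x [set w | (b <= (F \o val) w)%R])%:E =
    \int[leb]_(b in `[F 0%R, F x]) (G b)%:E)%E.
  rewrite FF [LHS]integral_mkcond [RHS]integral_mkcond.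
  apply: eq_integral => b _; rewrite !patchE.
  have [bF|bF] := boolP (0 <= b <= F x).
    have /andP[b0 bFx] := bF.
    rewrite ifT; last by rewrite inE/= in_itv/= b0.
    rewrite ifT; last by rewrite inE/= in_itv/=.
    have [/andP[g0 gx] Fg] := gP _ bF.
    congr EFin; apply: mu_slice_tail => //.
    apply/seteqP; split=> t /=.
      by move=> [tx bt]; rewrite -(Fmono _ _ g0 (I0 t)) Fg bt.
    move=> /andP[gt tx]; split; first exact: tx.
    by move: gt; rewrite -(Fmono _ _ g0 (I0 t)) Fg.
  rewrite [in RHS]ifF; last by apply/negbTE; rewrite notin_setE/= in_itv/=; exact/negP.
  case: ifPn => //; rewrite inE/= in_itv/= andbT => b0.
  have {}bF : F x < b by move: bF; rewrite b0/= -ltNge.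
  congr EFin; rewrite /mu_slice (_ : _ `&` _ = set0) ?mu01_0//.
  apply/seteqP; split=> // t /= [tx bt].
  have : F (val t) <= F x by rewrite (Fmono _ _ (I0 t) (ltW x0)).
  by rewrite leNgt (lt_le_trans bF bt).
rewrite lay.
have Fder : derivable_oo_LRcontinuous F 0 x.
  split.
  - by move=> t _; case: (is_derive_exp_tail n t).
  - by apply: cvg_at_right_filter; exact: exp_tail_continuous.
  - by apply: cvg_at_left_filter; exact: exp_tail_continuous.
rewrite (@integration_by_substitution_increasing R F G 0 x (ltW x0)); first last.
- move=> b; apply: (@cvg_comp _ _ _ (fun b => x - g b) distortion
    (nbhs (b : subspace `[F 0, F x]%classic)) (nbhs (x - g b))); last first.
    exact: distortion_continuous.
  apply: cvgB; first exact: cvg_cst.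
  exact: (segment_can_le_continuous (ltW x0) (Fcont _ _) FK).
- exact: Fder.
- rewrite derive1_exp_tail; apply: cvgP; apply: cvg_at_left_filter; exact: exp_term_continuous.
- rewrite derive1_exp_tail; apply: cvgP; apply: cvg_at_right_filter; exact: exp_term_continuous.
- by rewrite derive1_exp_tail => t _; exact: exp_term_continuous.
- by move=> s t; rewrite !in_itv/= => /andP[s0 _] _; exact: exp_tail_lt.
(* The exponentials in [distortion (x - t) * exp_term n t] combine to
   [exp_term n t - expR (- x) * t ^+ n / n!], with antiderivative [P]. Then [P x - P 0] is
   [exp_tail n.+1 x - exp_term n.+1 x], the next tail. *)
pose P : R -> R := F - expR (- x) *: (((n.+1)`!%:R)^-1 *: (id ^+ n.+1)).
have PE t : P t = F t - expR (- x) * (t ^+ n.+1 / n.+1`!%:R).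
  by rewrite /P [X in _ = _ - _ * X]mulrC; congr (_ - _ * (_ * _)); rewrite exprfctE.
have nE : (n.+1%:R : R) != 0 by rewrite pnatr_eq0.
have Pder (t : R) : is_derive t (1 : R) P (distortion (x - t) * exp_term n t).
  have ? := is_derive_exp_tail n t.
  rewrite /P; apply: is_derive_eq; rewrite /GRing.scale/= mulr1 /distortion mulrBl mul1r.
  congr (_ - _); rewrite /exp_term [RHS]mulrA -expRD; congr (_ * _); first by congr expR; ring.
  by rewrite factS natrM invfM mulrACA mulVf// mul1r mulrC.
have Pcont : continuous P.
  by move=> t; apply/differentiable_continuous/derivable1_diffP; case: (Pder t).
transitivity (fine (\int[leb]_(t in `[0%R, x]) (distortion (x - t) * exp_term n t)%:E)).
  congr fine; apply: eq_integral => t; rewrite inE/= => tI.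
  by rewrite derive1_exp_tail /= fctE /= /G FK.
have cf : {within `[0, x], continuous (fun t => distortion (x - t) * exp_term n t)}.
  apply: continuous_subspaceT => t; apply: cvgM; last exact: exp_term_continuous.
  apply: (@continuous_comp _ _ _ (fun t => x - t) distortion); last first.
    exact: distortion_continuous.
  by apply: cvgB; [exact: cvg_cst|exact: cvg_id].
rewrite (@continuous_FTC2 R _ P 0 x x0 cf).
- rewrite -EFinB/= !PE FF expr0n/= mul0r mulr0 subrr subr0.
  by rewrite exp_tailS.
- split.
  + by move=> t _; case: (Pder t).
  + by apply: cvg_at_right_filter; exact: Pcont.
  + by apply: cvg_at_left_filter; exact: Pcont.
- by move=> t _; rewrite derive1E; have ? := Pder t; rewrite derive_val.
Qed.

End volterra_exp_tail.

(** * Weierstrass approximation by Bernstein polynomials *)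

Section weierstrass.
Context {R : realType}.
Implicit Types (f : R -> R) (x : R).

Lemma segment_unif_continuous f (e : R) : continuous f -> 0 < e ->
  exists2 d : R, 0 < d & forall x y, 0 <= x <= 1 -> `|x - y| < d -> `|f x - f y| < e.
Proof.
move=> cf e0.
pose P (d x : R) := forall y, `|x - y| < d -> `|f x - f y| < e.
have /compact_near_coveringP cov := @segment_compact R 0 1.
have near0 : \forall d \near (0 : R)^'+, `[0, 1]%classic `<=` P d.
  suff nearx x : \forall x' \near x & d \near (0 : R)^'+, P d x' by apply: cov => x _.
  have /cvgrPdist_lt/(_ (e / 2)) := cf x.
  move=> /(_ (divr_gt0 e0 (ltr0Sn _ 1))) /nbhs_ballP[r /= r0 rf].
  have r2 : 0 < r / 2 by rewrite divr_gt0.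
  near=> x' d => y /= x'y.
  have xx' : `|x - x'| < r / 2 by near: x'; exact: nbhsx_ballx.
  have dr : d < r / 2 by near: d; exact: nbhs_right_lt.
  have fx' : `|f x - f x'| < e / 2 by apply: rf; rewrite -ball_normE/=; lra.
  have fy : `|f x - f y| < e / 2.
    by apply: rf; rewrite -ball_normE/=; have := ler_distD x' x y; lra.
  by have := ler_distD (f x) (f x') (f y); rewrite [`|f x' - f x|]distrC; lra.
have [d [d0 dP]] : exists d : R, 0 < d /\ `[0, 1]%classic `<=` P d.
  apply: (@filter_ex _ ((0 : R)^'+) _); near=> d; split.
    by near: d; exact: nbhs_right_gt.
  by near: d.
by exists d => // x y x01; apply: dP; rewrite /= in_itv.
Unshelve. all: by end_near. Qed.

Definition bernstein (n k : nat) x : R := 'C(n, k)%:R * x ^+ k * (1 - x) ^+ (n - k).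

Lemma bernstein_ge0 n k x : 0 <= x <= 1 -> 0 <= bernstein n k x.
Proof.
by move=> /andP[x0 x1]; rewrite /bernstein !mulr_ge0// exprn_ge0// subr_ge0.
Qed.

Lemma bernstein_sum n x : \sum_(k < n.+1) bernstein n k x = 1.
Proof.
rewrite -[RHS](expr1n _ n) -[in RHS](subrK x 1) exprDn; apply: eq_bigr => k _.
by rewrite /bernstein -mulrA mulr_natl [_ ^+ k * _]mulrC.
Qed.

(** The identity k C(n+1, k) = (n+1) C(n, k-1) absorbs a factor [k]; taking [phi] constant, then the
    identity, yields the first two moments of the binomial law. *)
Lemma bernstein_absorb n x (phi : nat -> R) :
  \sum_(k < n.+2) k%:R * phi k * bernstein n.+1 k x =
  n.+1%:R * x * \sum_(k < n.+1) phi k.+1 * bernstein n k x.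
Proof.
rewrite big_ord_recl/= !mul0r add0r mulr_sumr; apply: eq_bigr => k _.
rewrite /bernstein /bump/= add1n subSS exprS.
have := congr1 (fun m => m%:R : R) (mul_bin_diag n.+1 k); rewrite !natrM => E.
transitivity ((k.+1%:R * 'C(n.+1, k.+1)%:R) * (phi k.+1 * (x * x ^+ k) * (1 - x) ^+ (n - k))).
  by ring.
by rewrite -E; ring.
Qed.

Lemma bernstein_mean n x : \sum_(k < n.+1) k%:R * bernstein n k x = n%:R * x.
Proof.
case: n => [|n]; first by rewrite big_ord1 !mul0r.
have := bernstein_absorb n x (fun=> 1); under eq_bigr do rewrite mulr1.
by move=> ->; under eq_bigr do rewrite mul1r; rewrite bernstein_sum mulr1.
Qed.

Lemma bernstein_variance n x :
  \sum_(k < n.+2) (x - k%:R / n.+1%:R) ^+ 2 * bernstein n.+1 k x = x * (1 - x) / n.+1%:R.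
Proof.
have n0 : n.+1%:R != 0 :> R by rewrite pnatr_eq0.
have S2 : \sum_(k < n.+2) k%:R * k%:R * bernstein n.+1 k x = n.+1%:R * x * (n%:R * x + 1).
  rewrite (bernstein_absorb n x (fun k => k%:R)); congr (_ * _).
  rewrite -[RHS](congr2 +%R (bernstein_mean n x) (bernstein_sum n x)) -big_split/=.
  by apply: eq_bigr => k _; rewrite -natr1 mulrDl mul1r.
transitivity (x ^+ 2 * \sum_(k < n.+2) bernstein n.+1 k x
   - 2 * x / n.+1%:R * \sum_(k < n.+2) k%:R * bernstein n.+1 k x
   + n.+1%:R^-2 * \sum_(k < n.+2) k%:R * k%:R * bernstein n.+1 k x).
  rewrite !mulr_sumr -sumrB -big_split/=; apply: eq_bigr => k _.
  by rewrite -exprVn; ring.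
rewrite bernstein_sum bernstein_mean S2 -[n.+1%:R]natr1; field.
by rewrite natr1.
Qed.

(** Chebyshev's argument: nodes within [d] of [x] contribute at most [e / 2] by uniform continuity;
    at the others the difference is at most [2 * M], hence at most [2 * M / d ^+ 2] times the
    squared distance, whose mean is the binomial variance. *)
Lemma weierstrass f (e : R) : continuous f -> 0 < e ->
  exists p : {poly R}, forall x, 0 <= x <= 1 -> `|f x - p.[x]| < e.
Proof.
move=> cf e0.
have [d d0 fd] := segment_unif_continuous cf (divr_gt0 e0 (ltr0Sn _ 1)).
have [M M0 fM] : exists2 M : R, 0 < M & forall x, 0 <= x <= 1 -> `|f x| <= M.
  have cF : {within `[0, 1], continuous (Num.norm \o f)}.
    by apply: continuous_subspaceT => x; apply: cvg_norm; exact: cf.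
  have [b _ fb] := EVT_max ler01 cF.
  exists (`|f b| + 1); first by rewrite ltr_wpDl.
  by move=> x x01; rewrite (le_trans (fb x _))/= ?in_itv// lerDl.
(* This degree brings the variance term, at most [2 * M / d ^+ 2 / n.+1], below [e / 2]. *)
have [n nM] : exists n : nat, 4 * M / (d ^+ 2 * e) < n.+1%:R.
  exists (Num.truncn (4 * M / (d ^+ 2 * e))).
  have z0 : 0 <= 4 * M / (d ^+ 2 * e).
    by rewrite divr_ge0 ?mulr_ge0 ?exprn_ge0 ?(ltW M0) ?(ltW d0) ?(ltW e0).
  by have /andP[] := truncn_itv z0.
have n0 : 0 < n.+1%:R :> R by rewrite ltr0n.
exists (\sum_(k < n.+2) (f (k%:R / n.+1%:R) * 'C(n.+1, k)%:R) *:
          ('X^k * (1 - 'X) ^+ (n.+1 - k))) => x x01.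
rewrite horner_sum.
have -> : f x = \sum_(k < n.+2) f x * bernstein n.+1 k x.
  by rewrite -mulr_sumr bernstein_sum mulr1.
rewrite -sumrB.
have pt (k : 'I_n.+2) : `|f x * bernstein n.+1 k x
   - ((f (k%:R / n.+1%:R) * 'C(n.+1, k)%:R) *: ('X^k * (1 - 'X) ^+ (n.+1 - k))).[x]| <=
   (e / 2 + 2 * M / d ^+ 2 * (x - k%:R / n.+1%:R) ^+ 2) * bernstein n.+1 k x.
  have -> : ((f (k%:R / n.+1%:R) * 'C(n.+1, k)%:R) *: ('X^k * (1 - 'X) ^+ (n.+1 - k))).[x]
      = f (k%:R / n.+1%:R) * bernstein n.+1 k x.
    rewrite hornerZ hornerM hornerXn horner_exp hornerD hornerN hornerX hornerC.
    by rewrite /bernstein !mulrA.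
  rewrite -mulrBl normrM [`|bernstein _ _ _|]ger0_norm ?bernstein_ge0//.
  apply: ler_wpM2r; first exact: bernstein_ge0.
  set y := k%:R / _.
  have y01 : 0 <= y <= 1.
    by rewrite divr_ge0//= ler_pdivrMr// mul1r ler_nat -ltnS ltn_ord.
  have [xyd|xyd] := ltP `|x - y| d.
    apply: ler_wpDr; last exact: ltW (fd _ _ x01 xyd).
    by rewrite mulr_ge0 ?sqr_ge0// divr_ge0 ?sqr_ge0// mulr_ge0// ltW.
  apply: ler_wpDl; first by rewrite divr_ge0// ltW.
  apply: (@le_trans _ _ (2 * M)).
    apply: le_trans (ler_normB _ _) _.
    have := fM _ x01; have := fM _ y01; lra.
  rewrite -mulrA ler_peMr ?mulr_ge0// ?(ltW M0)// mulrC ler_pdivlMr ?exprn_gt0// mul1r.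
  by rewrite -[leRHS]real_normK ?num_real// ler_sqr ?nnegrE// ltW.
apply: le_lt_trans (ler_norm_sum _ _ _) _.
apply: le_lt_trans (ler_sum _ (fun k _ => pt k)) _.
under eq_bigr do rewrite mulrDl -[_ * _ ^+ 2 * _]mulrA.
rewrite big_split/= -!mulr_sumr bernstein_sum bernstein_variance mulr1.
have xx : x * (1 - x) <= 1 by nra.
have : 2 * M / d ^+ 2 * (x * (1 - x) / n.+1%:R) < e / 2.
  apply: (@le_lt_trans _ _ (2 * M / d ^+ 2 * (1 / n.+1%:R))).
    apply: ler_wpM2l; first by rewrite divr_ge0 ?sqr_ge0// mulr_ge0// ltW.
    by rewrite ler_wpM2r// invr_ge0 ltW.
  rewrite mul1r ltr_pdivrMr// mulrC.
  move: nM; rewrite ltr_pdivrMr ?mulr_gt0 ?exprn_gt0// => nM.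
  rewrite ltr_pdivrMl ?exprn_gt0//; nra.
by move=> H; rewrite [ltRHS]splitr; exact: ler_ltD.
Qed.

End weierstrass.

(** * Lipschitz maps and dense sets in a normed space *)

Section normed_operators.
Context {R : realType} {X : normedModType R}.

Lemma contraction_continuous (T : X -> X) (k : R) : 0 < k ->
  (forall f g, `|T f - T g| <= k * `|f - g|) -> continuous T.
Proof.
move=> k0 Tk f; apply/cvgrPdist_lt => e e0; near=> g.
apply: le_lt_trans (Tk f g) _; rewrite mulrC -ltr_pdivlMr//.
by near: g; apply: cvgr_dist_lt => //; rewrite divr_gt0.
Unshelve. all: by end_near. Qed.

Lemma dense_approx (S : set X) :
  (forall f e, 0 < e -> exists2 g, S g & `|f - g| < e) -> dense S.
Proof.
move=> H O [f Of] oO; have /nbhs_ballP[e /= e0 eO] := open_nbhs_nbhs (conj oO Of).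
have [g Sg fg] := H f e e0; exists g; split=> //; apply: eO.
by rewrite -ball_normE.
Qed.

End normed_operators.

(** * Functions on the unit interval and uniform density of the span *)

Section unit_interval.
Context {R : realType}.
Local Notation leb := (@lebesgue_measure R).

Lemma clamp01_subproof (x : R) : Num.max 0 (Num.min 1 x) \in I01 R.
Proof.
by rewrite inE /I01/= in_itv/= le_max lexx ge_max ler01 ge_min lexx.
Qed.

(** A continuous retraction of the line onto the unit interval: composing with it extends functions
    on the subtype to the line, where the classical theorems apply. *)
Definition clamp01 (x : R) : I01 R := SigSub (clamp01_subproof x).

Lemma I01P (t : I01 R) : 0 <= val t <= 1.
Proof. by have := set_valP t; rewrite /I01/= in_itv. Qed.

Lemma clamp01K (t : I01 R) : clamp01 (val t) = t.
Proof.
apply/val_inj => /=; have /andP[t0 t1] := I01P t.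
by rewrite (min_idPr t1) (max_idPr t0).
Qed.

Lemma clamp01_continuous : continuous clamp01.
Proof.
apply: continuous_comp_initial => x.
rewrite /comp/=.
apply: continuous_max; first exact: cst_continuous.
by apply: continuous_min; [exact: cst_continuous|exact: id].
Qed.

Lemma val_continuous : continuous (val : I01 R -> R).
Proof. exact: initial_continuous. Qed.

Lemma measurable_comp_val (c : sigma_alg) (F : R -> R) : measurable_fun setT F ->
  measurable_fun [set: I01c R c] ((fun t : I01 R => F (val t)) : I01c R c -> R).
Proof.
move=> mF _ Y mY; rewrite setTI -[measurable _]/(csets c _) csetsE; apply: rsets_borel.
rewrite (_ : _ @` _ = `[0, 1] `&` (F @^-1` Y)).
  apply: measurableI; first exact: measurable_itv.
  by rewrite -[F @^-1` Y]setTI; exact: mF.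
apply/seteqP; split=> y /=.
  by move=> [t Ft <-]; split; [exact: (set_valP t)|].
by move=> [yI Fy]; exists (exist _ y (mem_set yI)).
Qed.

Lemma measurable_continuous01 (c : sigma_alg) (f : I01 R -> R) : continuous f ->
  measurable_fun [set: I01c R c] (f : I01c R c -> R).
Proof.
move=> cf; have -> : f = fun t => (f \o clamp01) (val t).
  by apply/funext => t /=; rewrite clamp01K.
apply: measurable_comp_val; apply: continuous_measurable_fun => x.
by apply: continuous_comp; [exact: clamp01_continuous|exact: cf].
Qed.

Lemma mu01T_le1 : mu01 [set: I01 R] <= 1.
Proof. by rewrite /mu01 /distortion lerBlDr lerDl expR_ge0. Qed.

Lemma layer_bounded (f : I01 R -> R) (M : R) : 0 <= M -> (forall t, f t <= M) ->
  (layer mu01 f <= M%:E)%E.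
Proof.
move=> M0 fM; have mu0 := @mu01_0 R; have mono := @mu01_mono R.
apply: le_trans (le_layer mu0 mono fM) _.
apply: le_trans (layer_cst_le mu0 mono M0) _.
by rewrite lee_fin ler_piMr// mu01T_le1.
Qed.

Lemma integrable01_bounded (c : sigma_alg) (f : I01 R -> R) (M : R) : 0 <= M ->
  measurable_fun [set: I01c R c] (f : I01c R c -> R) -> (forall t, `|f t| <= M) ->
  integrable01 c f.
Proof.
by move=> M0 mf fM; split=> //; exact: le_lt_trans (layer_bounded M0 fM) (ltry _).
Qed.

Lemma exp_tail_dense (f : R -> R) (e : R) : continuous f -> 0 < e ->
  exists n (a : 'I_n -> R), forall x, 0 <= x <= 1 ->
    `|f x - \sum_(i < n) a i * exp_tail i x| < e.
Proof.
move=> cf e0.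
have [|p fp] := @weierstrass R (fun x => f x * expR x) e _ e0.
  by move=> x; apply: cvgM; [exact: cf|exact: continuous_expR].
pose d i := p`_i * i`!%:R.
(* Summation by parts: [d i * exp_term i x] is the term of degree [i] in [expR (- x) * p.[x]], and
   each weight is a difference of consecutive tails. The last tail has index [size p], hence one
   extra coefficient. *)
exists (size p).+1, (fun i => d i - (if i : nat is j.+1 then d j else 0)) => x x01.
have -> : \sum_(i < (size p).+1) (d i - (if i : nat is j.+1 then d j else 0)) * exp_tail i x
    = expR (- x) * p.[x].
  under eq_bigr do rewrite mulrBl.
  rewrite sumrB big_ord_recr/= [X in _ - X]big_ord_recl/= mul0r add0r.
  rewrite /d nth_default// !mul0r addr0 -sumrB horner_coef mulr_sumr.
  apply: eq_bigr => i _; rewrite /bump/= add1n exp_tailS /exp_term.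
  have iE : (i`!%:R : R) != 0 by rewrite pnatr_eq0 -lt0n fact_gt0.
  by field.
have -> : f x - expR (- x) * p.[x] = expR (- x) * (f x * expR x - p.[x]).
  by rewrite mulrBr mulrCA -expRD addNr expR0 mulr1.
rewrite normrM ger0_norm ?expR_ge0//; apply: le_lt_trans (fp _ x01).
rewrite ler_piMl// -[leRHS]expR0 ler_expR oppr_le0.
by case/andP: x01.
Qed.

End unit_interval.

(** * Lusin's theorem for [mu01] and both sigma-algebras *)

Section lusin_unit_interval.
Context {R : realType}.
Variable c : sigma_alg.
Local Notation leb := (@lebesgue_measure R).

Lemma rsets_mod_null (S : set R) : rsets c S -> exists N : set R,
  [/\ measurable N, leb N = 0%E & measurable (S `\` N)].
Proof.
rewrite /rsets; case: c => [mS|[B mB [N0 [N [mN N_0 NN]] <-]]].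
  by exists set0; rewrite measure0 setD0.
exists N; split => //; rewrite setDUl (_ : N0 `\` N = set0) ?setU0.
  exact: measurableD.
by apply/seteqP; split=> // x [/NN].
Qed.

(** Reduces the Lebesgue case to Borel functions, to which Lusin's theorem is applied. Superlevel
    sets at rational levels determine all the others, so the null sets to be removed are countably
    many. *)
Lemma measurable_mod_null (f : I01 R -> R) :
  measurable_fun [set: I01c R c] (f : I01c R c -> R) -> exists N : set R,
  [/\ measurable N, leb N = 0%E & measurable_fun (`[0, 1] `\` N) (f \o clamp01)].
Proof.
move=> mf; set F := f \o clamp01.
pose S (q : rat) : set R := `[0, 1] `&` [set y | ratr q < F y].
have rS q : rsets c (S q).
  have := mf measurableT `](ratr q), +oo[%classic (measurable_itv _).
  rewrite setTI -[measurable _]/(csets c _) csetsE; congr (rsets c _).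
  apply/seteqP; split=> y /=.
    move=> [t]; rewrite /= in_itv/= andbT => ft <-; split; first exact: (set_valP t).
    by rewrite /F /= clamp01K.
  move=> [yI Fy]; exists (SigSub (mem_set yI) : I01 R) => //=.
  rewrite in_itv/= andbT; move: Fy; rewrite /F/=.
  by rewrite -[X in clamp01 X]/(val (SigSub (mem_set yI) : I01 R)) clamp01K.
have /choice[N NP] := fun q => rsets_mod_null (rS q).
pose N' n := if unpickle n is Some q then N q else set0.
have mN' n : measurable (N' n).
  by rewrite /N'; case: unpickle => // q; have [] := NP q.
have mN : measurable (\bigcup_n N' n) by exact: bigcupT_measurable.
exists (\bigcup_n N' n); split => //.
  apply: measure_negligible => //; apply: negligible_bigcup => n.
  exists (N' n); split; [exact: mN'| |exact: subset_refl].
  rewrite /N'; case: unpickle => [q|]; last exact: measure0.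
  by have [] := NP q.
move=> mD; apply: (measurability _ (RGenOInfty.measurableE R)) => //.
move=> /= _ [_ [a ->] <-]; rewrite preimage_itvoy.
rewrite [X in measurable X](_ : _ = \bigcup_(q : rat)
  (if a < ratr q then (S q `\` N q) `\` \bigcup_n N' n else set0)); last first.
  apply/seteqP; split=> y /=.
    move=> [[yI nN] ay]; have [q] := rat_in_itvoo ay; rewrite in_itv/= => /andP[aq qF].
    exists q; first by []; rewrite aq; split; last exact: nN.
    split; first by split.
    move=> Nq; apply: nN; exists (pickle q); first by []; rewrite /N' pickleK; exact: Nq.
  move=> [q _]; case: ifP => [aq [[[yI qF] _] nN]|_ []].
  by split; [split|exact: lt_trans aq qF].
apply: bigcupT_measurable_rat => q; case: ifP => // _.
by apply: measurableD => //; have [] := NP q.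
Qed.

Lemma leb01_le_measure (B : set (I01 R)) (A : set R) (d : R) :
  set_val @` B `<=` A -> (leb A <= d%:E)%E -> leb01 B <= d.
Proof.
move=> BA Ad; rewrite -lee_fin /leb01 fineK ?leb_fin//.
exact: le_trans (leb_mono BA) Ad.
Qed.

Lemma mu01_le_leb01 (B : set (I01 R)) : mu01 B <= leb01 B.
Proof.
by rewrite /mu01 /distortion lerBlDr -lerBlDl; exact: expR_ge1Dx.
Qed.

(** Lusin's theorem gives a compact set on which [f] is continuous, and Tietze's extension keeps the
    bound [M]. The exceptional set is small for [mu01] because 1 - exp (- x) <= x. *)
Lemma lusin01 (f : I01 R -> R) (M e : R) : 0 < M -> 0 < e ->
  measurable_fun [set: I01c R c] (f : I01c R c -> R) -> (forall t, `|f t| <= M) ->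
  exists g : R -> R, [/\ continuous g, forall x, `|g x| <= M &
    mu01 [set t | f t != g (val t)] <= e].
Proof.
move=> M0 e0 mf fM; have [N [mN N0 mF]] := measurable_mod_null mf.
have mD : measurable (`[0, 1] `\` N : set R) by exact: measurableD.
have Dfin : (leb (`[0%R, 1%R] `\` N) < +oo)%E.
  apply: (@le_lt_trans _ _ (leb `[0%R, 1%R]%classic)).
    by apply: leb_mono; exact: subDsetl.
  by rewrite lebesgue_measure_itv/= lte_fin ltr01 -EFinB ltry.
have [K [cK KD De cF]] := measurable_almost_continuous mD Dfin e0 mF.
have [|||g [gF cg gM]] := @continuous_bounded_extension R R _ K _ (f \o clamp01) M M0 cF.
- exact: pseudometric_normal.
- by apply: compact_closed => //; exact: Rhausdorff.
- by move=> x _; exact: fM.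
exists g; split=> //; apply: le_trans (mu01_le_leb01 _) _.
apply: (@leb01_le_measure _ ((`[0, 1] `\` N `\` K) `|` N)).
  move=> _ [t /= fg <-]; have [Nt|nNt] := pselect (N (val t)); [by right|left].
  split; first by split=> //; exact: (set_valP t).
  move=> Kt; move/eqP: fg; apply; rewrite -gF ?inE//=.
  by rewrite clamp01K.
apply: le_trans (measureU2 _ _ _) _ => //.
  by apply: measurableD => //; exact: compact_measurable.
by rewrite -[X in (_ + X)%E]/(leb N) N0 adde0 ltW.
Qed.

End lusin_unit_interval.

(** * Approximation in L_p and control of the Choquet integral by the L_p norm *)

Section lp_density.
Context {R : realType}.
Variables (c : sigma_alg) (p : R) (hp : 1 <= p).
Implicit Types f g : I01 R -> R.

Let p0 : 0 < p. Proof. exact: lt_le_trans ltr01 hp. Qed.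

Lemma layer_Lpow_bounded f (M : R) : 0 <= M -> (forall t, `|f t| <= M) ->
  (layer mu01 (Lpow p f) <= (M `^ p)%:E)%E.
Proof.
move=> M0 fM; apply: layer_bounded; first exact: powR_ge0.
by move=> t; rewrite /Lpow ge0_ler_powR ?nnegrE// ltW.
Qed.

Lemma Lpnorm_bounded f (M : R) : 0 <= M -> (forall t, `|f t| <= M) -> Lpnorm p f <= M.
Proof. by move=> M0 fM; apply: (Lpnorm_le hp M0); exact: layer_Lpow_bounded. Qed.

Lemma bounded_calL f (M : R) : 0 <= M ->
  measurable_fun [set: I01c R c] (f : I01c R c -> R) -> (forall t, `|f t| <= M) ->
  f \in calL_pred c hp.
Proof.
move=> M0 mf fM; apply/calLP; split; first exact: mf.
exact: le_lt_trans (layer_Lpow_bounded M0 fM) (ltry _).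
Qed.

Lemma cvg_Lpnorm0 (f_ : (I01 R -> R)^nat) (v : I01 R -> R) (e : R) : 0 < e ->
  (forall n t, Lpow p (f_ n) t <= v t) -> (layer mu01 v < +oo)%E ->
  (forall b, 0 < b -> mu01 [set w | b <= Lpow p (f_ n) w] @[n --> \oo] --> 0) ->
  exists n, Lpnorm p (f_ n) <= e.
Proof.
move=> e0 fv vfin f0.
have /fine_cvgP[fin cv] := cvg_layer0 (@mu01_0 R) (@mu01_mono R) fv vfin f0.
have ep : 0 < e `^ p by exact: powR_gt0.
apply: (@filter_ex _ \oo); near=> n; apply: (Lpnorm_le hp (ltW e0)).
have fn : layer mu01 (Lpow p (f_ n)) \is a fin_num by near: n; exact: fin.
rewrite -(fineK fn) lee_fin; apply: ltW; near: n.
exact: (cvgr_lt _ cv).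
Unshelve. all: by end_near. Qed.

(** The difference is bounded by [M + M], and its superlevel sets at positive levels lie in the
    exceptional set, whose [mu01] tends to 0. *)
Lemma Lpnorm_lusin f (M e : R) : 0 < M -> 0 < e ->
  measurable_fun [set: I01c R c] (f : I01c R c -> R) -> (forall t, `|f t| <= M) ->
  exists g : R -> R, [/\ continuous g, forall x, `|g x| <= M &
    Lpnorm p (fun t => f t - g (val t)) <= e].
Proof.
move=> M0 e0 mf fM.
have /choice[g gP] : forall n : nat, exists g : R -> R, [/\ continuous g,
    forall x, `|g x| <= M & mu01 [set t | f t != g (val t)] <= n.+1%:R^-1].
  by move=> n; apply: (lusin01 M0 _ mf fM); rewrite invr_gt0.
have [n nP] : exists n, Lpnorm p (fun t => f t - g n (val t)) <= e.
  apply: (@cvg_Lpnorm0 _ (fun=> (M + M) `^ p) e e0).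
  - move=> n t; rewrite /Lpow ge0_ler_powR ?nnegrE ?(ltW p0) ?addr_ge0 ?(ltW M0)//.
    have [_ gM _] := gP n; apply: le_trans (ler_normB _ _) _.
    by apply: lerD; [exact: fM|exact: gM].
  - apply: le_lt_trans (ltry ((M + M) `^ p)).
    by apply: layer_bounded; first exact: powR_ge0.
  - move=> b b0; apply: (@squeeze_cvgr _ _ _ _ (cst 0) (fun n => n.+1%:R^-1)).
    + apply: nearW => n; rewrite (monset_ge0 (@mu01_0 R) (@mu01_mono R))/=.
      have [_ _ gn] := gP n; apply: le_trans gn; apply: mu01_mono => t /= bt.
      apply/eqP => E; move: bt; rewrite /Lpow E subrr normr0 powR0 ?gt_eqF//.
      by rewrite leNgt b0.
    + exact: cvg_cst.
    + exact: cvg_harmonic.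
by have [cg gM _] := gP n; exists (g n).
Qed.

Definition clip (M x : R) : R := Num.max (- M) (Num.min M x).

Lemma clip_le (M x : R) : 0 <= M -> `|clip M x| <= M.
Proof.
by move=> M0; rewrite ler_norml /clip le_max lexx/= ge_max ge_min lexx/= andbT; lra.
Qed.

Lemma sub_clip_le (M x : R) : 0 <= M -> `|x - clip M x| <= `|x|.
Proof.
move=> M0; rewrite /clip; case: (leP M x) => Mx.
  by rewrite (max_idPr _) ?ger0_norm; lra.
case: (leP (- M) x) => Mx'; first by rewrite subrr normr0.
by rewrite !ltr0_norm; lra.
Qed.

Lemma sub_clip_eq0 (M x : R) : `|x| < M -> x - clip M x = 0.
Proof.
rewrite ltr_norml => /andP[Mx xM]; rewrite /clip.
by rewrite (min_idPr (ltW xM)) (max_idPr (ltW Mx)) subrr.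
Qed.

(** The difference vanishes where [|f| < n.+1]. Markov's inequality, read off a single slab of
    height [n.+1], makes the rest small; there [|f| >= 1], so [|f|] is at most its [p]-th power. *)
Lemma Lpnorm_clip f (e : R) : 0 < e -> f \in calL_pred c hp ->
  exists2 M, 0 < M & Lpnorm p (fun t => f t - clip M (f t)) <= e.
Proof.
move=> e0 /calLP[mf fin].
have [n nP] : exists n, Lpnorm p (fun t => f t - clip n.+1%:R (f t)) <= e.
  apply: (@cvg_Lpnorm0 _ (Lpow p f) e e0) => //.
    move=> n t; rewrite /Lpow ge0_ler_powR ?nnegrE// ?(ltW p0)//.
    exact: sub_clip_le.
  move=> b b0; set L := fine (layer mu01 (Lpow p f)).
  have LE : layer mu01 (Lpow p f) = L%:E.
    by rewrite /L fineK// ge0_fin_numE ?Jm_ge0.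
  apply: (@squeeze_cvgr _ _ _ _ (cst 0) (fun n => L * n.+1%:R^-1)).
  - apply: nearW => n; rewrite (monset_ge0 (@mu01_0 R) (@mu01_mono R))/=.
    rewrite ler_pdivlMr ?ltr0n//.
    have := rsum_le_layer (@mu01_0 R) (@mu01_mono R) (Lpow p f) 1 (ltr0Sn R n).
    rewrite /rsum big_ord1 LE lee_fin; apply: le_trans.
    rewrite [leLHS]mulrC; apply: ler_wpM2l; first exact: ler0n.
    apply: mu01_mono => t /= bt; rewrite mul1r.
    have nf : n.+1%:R <= `|f t|.
      rewrite leNgt; apply/negP => /sub_clip_eq0 E.
      by move: bt; rewrite /Lpow E normr0 powR0 ?gt_eqF// leNgt b0.
    apply: (le_trans nf); rewrite /Lpow -[leLHS]powRr1//.
    by rewrite ler_powR// (le_trans _ nf)// ler1n.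
  - exact: cvg_cst.
  - rewrite -[X in _ --> X](mulr0 L); apply: cvgM; first exact: cvg_cst.
    exact: cvg_harmonic.
by exists n.+1%:R.
Qed.

Lemma measurable_clip (M : R) f : measurable_fun [set: I01c R c] (f : I01c R c -> R) ->
  measurable_fun [set: I01c R c] ((fun t => clip M (f t)) : I01c R c -> R).
Proof.
by move=> mf; apply: measurable_maxr => //; apply: measurable_minr.
Qed.

Lemma calLB f g : f \in calL_pred c hp -> g \in calL_pred c hp -> f - g \in calL_pred c hp.
Proof.
move=> Lf Lg; rewrite addrC -scaleN1r.
by have [_ H] := @calL_submod R c p hp; apply: (H (-1) g f Lg Lf).
Qed.

Lemma exp_tail_dense_Lp f (e : R) : 0 < e -> f \in calL_pred c hp ->
  exists n (a : 'I_n -> R),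
    Lpnorm p (fun t => f t - \sum_(i < n) a i * exp_tail i (val t)) < e.
Proof.
(* Three errors, from clipping, Lusin's theorem and the uniform approximation, each at most a
   quarter of [e], leave room for the strict inequality. *)
move=> e0; have ar (x y z s1 s2 : R) : s1 <= x + s2 -> s2 <= y + z ->
  x <= e / 4 -> y <= e / 4 -> z <= e / 4 -> s1 < e by lra.
move=> Lf; have e4 : 0 < e / 4 by rewrite divr_gt0.
have [M M0 fM] := Lpnorm_clip e4 Lf.
have [mf _] := calLP _ _ _ Lf.
have cM t : `|clip M (f t)| <= M by apply: clip_le; exact: ltW.
have mclip := measurable_clip M mf.
have [g [cg gM fg]] := Lpnorm_lusin M0 e4 mclip cM.
have [n [a ga]] := exp_tail_dense cg e4.
exists n, a.
set u : I01 R -> R := fun t => clip M (f t).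
set v : I01 R -> R := fun t => g (val t).
set w : I01 R -> R := fun t => \sum_(i < n) a i * exp_tail i (val t).
have Lu : u \in calL_pred c hp by apply: (bounded_calL (ltW M0)).
have Lv : v \in calL_pred c hp.
  apply: (bounded_calL (ltW M0)); last by move=> t; exact: gM.
  by apply: measurable_comp_val; exact: continuous_measurable_fun.
have vw t : `|(v - w) t| <= e / 4 by apply: ltW; apply: ga; exact: I01P.
have mw : measurable_fun [set: I01c R c] (w : I01c R c -> R).
  apply: (@measurable_comp_val _ c (fun x => \sum_(i < n) a i * exp_tail i x)).
  apply: measurable_sum => i; apply: measurable_funM => //.
  by apply: continuous_measurable_fun; exact: exp_tail_continuous.
have Lvw : v - w \in calL_pred c hp.
  apply: (bounded_calL (ltW e4)) => //; apply: measurable_funB => //.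
  by case: (calLP _ _ _ Lv).
have -> : (fun t => f t - w t) = (f - u) + ((u - v) + (v - w)).
  by apply/funext => t; rewrite !fctE/=; ring.
have Lfu := calLB Lf Lu.
have Luv := calLB Lu Lv.
have Luw := calL_add Luv Lvw.
exact: (ar _ _ _ _ _ (LpnormD Lfu Luw) (LpnormD Luv Lvw) fM fg (Lpnorm_bounded (ltW e4) vw)).
Qed.

(** Plays the part of Hölder's inequality: either [|f| <= d], or the factor [(|f| / d) ^ (p - 1)] is
    at least 1. The resulting pointwise bound is integrated with total mass at most 1, each summand
    costing at most [d]. *)
Lemma layer_le_Lpnorm f (d : R) : 0 < d -> f \in calL_pred c hp -> Lpnorm p f <= d ->
  (layer mu01 (fun t => `|f t|)%R <= (2 * d)%:E)%E.
Proof.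
move=> d0 Lf fd; have mu0 := @mu01_0 R; have mono := @mu01_mono R.
have [mf _] := calLP _ _ _ Lf.
have dp : 0 < d `^ p by exact: powR_gt0.
have k0 : 0 < d / d `^ p by exact: divr_gt0.
have le1 t : `|f t| <= d + d / d `^ p * Lpow p f t.
  rewrite /Lpow; have [fd'|df] := leP `|f t| d.
    by rewrite ler_wpDr// mulr_ge0 ?powR_ge0// ltW.
  rewrite ler_wpDl ?(ltW d0)// mulrAC ler_pdivlMr//.
  have f0 : 0 < `|f t| by exact: lt_trans d0 df.
  have E x : 0 < x -> x `^ p = x * x `^ (p - 1).
    move=> x0; rewrite -{2}[x]powRr1 ?ltW// -powRD; last by apply/implyP => _; rewrite gt_eqF.
    by rewrite addrC subrK.
  rewrite !E// mulrCA ler_pM2l// ler_pM2l//.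
  by rewrite ge0_ler_powR ?nnegrE ?subr_ge0 ?(ltW d0) ?(ltW f0) ?(ltW df).
apply: le_trans (le_layer mu0 mono le1) _.
have mcst : clev (csets c) ((fun=> d) : I01 R -> R).
  by apply: (@measurable_clev _ c (fun=> d)); exact: measurable_cst.
have add := layer_add mu0 mono (@csetsU R c) (@csetsI R c) (@mu01_submod R c)
  (fun=> ltW d0) (fun t => mulr_ge0 (ltW k0) (Lpow_ge0 p f t)) mcst
  (Lpow_clev p (d / d `^ p) mf).
apply: le_trans add _.
rewrite mulrDl mul1r EFinD; apply: leeD.
  by apply: layer_bounded => //; exact: ltW.
apply: le_trans (layer_scale mu0 mono (Lpow p f) k0) _.
rewrite (LpnormE Lf) -EFinM lee_fin mulrAC ler_pdivrMr// ler_pM2l//.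
by rewrite ge0_ler_powR ?nnegrE ?Lpnorm_ge0 ?(ltW p0) ?(ltW d0).
Qed.

Lemma calL_integrable01 f : f \in calL_pred c hp -> integrable01 c f.
Proof.
move=> Lf; split; first by case: (calLP _ _ _ Lf).
have d0 : 0 < Lpnorm p f + 1 by rewrite ltr_wpDl ?Lpnorm_ge0.
apply: le_lt_trans (layer_le_Lpnorm d0 Lf _) (ltry _).
by rewrite lerDl.
Qed.

Lemma volterra_fun_Lpnorm f g (x : R) : f \in calL_pred c hp -> g \in calL_pred c hp ->
  `|volterra_fun f x - volterra_fun g x| <= 2 * Lpnorm p (f - g).
Proof.
(* The slack [e] supplies a positive [d] for [layer_le_Lpnorm] even when the norm vanishes. *)
move=> Lf Lg; apply/ler_addgt0Pr => e e0.
have d0 : 0 < Lpnorm p (f - g) + e / 2.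
  by rewrite ltr_wpDl ?Lpnorm_ge0// divr_gt0.
rewrite (_ : _ + e = 2 * (Lpnorm p (f - g) + e / 2)); last by field.
apply: (@volterra_fun_dist _ c); [exact: calL_integrable01|exact: calL_integrable01|].
apply: (@layer_le_Lpnorm (f - g)); [exact: d0|exact: calLB|].
by rewrite lerDl divr_ge0// ltW.
Qed.

End lp_density.

(** * The operator on C[0, 1] *)

Section volterra_operator.
Context {R : realType}.
Implicit Types f : I01 R -> R.

Definition volterra01 f : I01 R -> R := fun x => volterra_fun f (val x).

Lemma volterra01_continuous (c : sigma_alg) f : integrable01 c f -> continuous (volterra01 f).
Proof.
move=> intf x; apply: (@continuous_comp _ _ _ (val : I01 R -> R) (volterra_fun f)).
  exact: val_continuous.
apply: (volterra_fun_continuous intf); rewrite inE/= in_itv/=.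
have /andP[x0 x1] := I01P x; apply/andP; split.
  exact: lt_le_trans (ltrN10 R) x0.
by apply: le_lt_trans x1 _; rewrite ltr1n.
Qed.

Lemma volterra01_exp_tail n : volterra01 (exp_tail n \o val) = exp_tail n.+1 \o val.
Proof. by apply/funext => x; apply: volterra_fun_exp_tail; exact: I01P. Qed.

Lemma exp_tail01_continuous n : continuous (exp_tail n \o val : I01 R -> R).
Proof.
by move=> x; apply: continuous_comp; [exact: val_continuous|exact: exp_tail_continuous].
Qed.

Lemma C01_continuous (f : C01 R) : continuous (f : I01 R -> R).
Proof. by case: f => f /= /asboolP. Qed.

Lemma C01_integrable01 (c : sigma_alg) (f : C01 R) : integrable01 c f.
Proof.
apply: (@integrable01_bounded _ c f (unorm f)).
- exact: le_trans (normr_ge0 _) (unorm_ub f (clamp01 0)).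
- exact: (@measurable_continuous01 R c f (@C01_continuous f)).
- exact: unorm_ub.
Qed.

Lemma C01_of_continuous f : continuous f -> f \in cont01.
Proof. by move=> cf; apply/asboolP. Qed.

Definition C01_volterra (f : C01 R) : C01 R :=
  MkC01 (C01_of_continuous (volterra01_continuous (C01_integrable01 Borel f))).

Lemma unorm_le (f : C01 R) (d : R) : (forall x, `|f x| <= d) -> unorm f <= d.
Proof. by move=> fd; apply: ge_sup; [exact: C01_nonempty|move=> _ [x _ <-]]. Qed.

Lemma C01_volterra_continuous : continuous C01_volterra.
Proof.
apply: (@contraction_continuous R (C01 R) C01_volterra 1 ltr01) => f g; rewrite mul1r.
apply: unorm_le => x.
apply: (@volterra_fun_dist _ Borel f g); [exact: C01_integrable01|exact: C01_integrable01|].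
apply: layer_bounded; first exact: normr_ge0.
by move=> t; exact: (unorm_ub (f - g)).
Qed.

Lemma C01_sum n (s : 'I_n -> C01 R) (a : 'I_n -> R) x :
  (\sum_(i < n) a i *: s i) x = \sum_(i < n) a i * s i x.
Proof. by elim/big_rec2: _ => // i y1 y2 _ <-. Qed.

Lemma C01_volterra_cyclic : cyclic_operator C01_volterra.
Proof.
split; first exact: C01_volterra_continuous.
pose e0 : C01 R := MkC01 (C01_of_continuous (@exp_tail01_continuous 0)).
have eE n x : iter n C01_volterra e0 x = exp_tail n (val x).
  elim: n x => // n IH x; rewrite iterS.
  rewrite -[RHS]/((exp_tail n.+1 \o val) x) -volterra01_exp_tail.
  by congr (volterra01 _ x); apply/funext => t; exact: IH.
exists e0; apply: dense_approx => f e e_gt0.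
have cf : continuous (f \o clamp01).
  by move=> x; apply: continuous_comp; [exact: clamp01_continuous|exact: C01_continuous].
(* Strict pointwise bounds give only a weak bound on the supremum, hence the halving. *)
have e2 : 0 < e / 2 by rewrite divr_gt0.
have [n [a fa]] := exp_tail_dense cf e2.
exists (\sum_(i < n) a i *: iter i C01_volterra e0).
  by exists n, a, (fun i => iter i C01_volterra e0); split => // i; exists i.
apply: (@le_lt_trans _ _ (e / 2)); last by rewrite gtr_pMr// invf_lt1 ?ltr1n.
apply: unorm_le => x.
have -> : (f - \sum_(i < n) a i *: iter i C01_volterra e0) x =
    (f \o clamp01) (val x) - \sum_(i < n) a i * exp_tail i (val x).
  rewrite /= clamp01K; congr (f x - _); rewrite C01_sum.
  by apply: eq_bigr => i _; rewrite eE.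
exact/ltW/fa/I01P.
Qed.

End volterra_operator.

(** * The operator on the quotient L_p *)

Section volterra_Lp.
Context {R : realType}.
Variables (c : sigma_alg) (p : R) (hp : 1 <= p).

Lemma calL_of_continuous (f : I01 R -> R) : continuous f -> f \in calL_pred c hp.
Proof.
move=> cf; pose F := MkC01 (C01_of_continuous cf).
apply: (@bounded_calL _ c p hp f (unorm F)).
- exact: le_trans (normr_ge0 _) (unorm_ub F (clamp01 0)).
- exact: measurable_continuous01.
- exact: unorm_ub F.
Qed.

Definition calL_volterra (f : calL c hp) : calL c hp :=
  MkCalL (calL_of_continuous (volterra01_continuous (calL_integrable01 (valP f)))).

Definition Lp_volterra (x : Lp c hp) : Lp c hp := Lclass (calL_volterra (Lrepr x)).

Lemma calL_volterra_dist (f g : calL c hp) :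
  Lpnorm p (calL_volterra f - calL_volterra g) <= 2 * Lpnorm p (f - g).
Proof.
apply: (Lpnorm_bounded hp); first by rewrite mulr_ge0 ?Lpnorm_ge0.
by move=> x; exact: volterra_fun_Lpnorm (valP f) (valP g).
Qed.

Lemma Lp_volterraE (f : calL c hp) : Lp_volterra (Lclass f) = Lclass (calL_volterra f).
Proof.
apply/LclassP; apply/eqP; rewrite eq_le Lpnorm_ge0 andbT.
apply: le_trans (calL_volterra_dist _ _) _.
have -> : Lpnorm p (Lrepr (Lclass f) - f) = 0 by apply/LclassP; exact: LreprK.
by rewrite mulr0.
Qed.

Lemma LclassB (f g : calL c hp) : Lclass f - Lclass g = Lclass (f - g).
Proof. by rewrite LclassD -[- g]scaleN1r LclassZ -[Lscale _ _]/(-1 *: Lclass g) scaleN1r. Qed.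

Lemma norm_LclassB (f g : calL c hp) : `|Lclass f - Lclass g| = Lpnorm p (f - g).
Proof. by rewrite LclassB; exact: Lnrm_class. Qed.

Lemma Lp_volterra_continuous : continuous Lp_volterra.
Proof.
apply: (@contraction_continuous R (Lp c hp) Lp_volterra 2) => // x y.
rewrite -[x in leRHS]LreprK -[y in leRHS]LreprK !norm_LclassB.
exact: calL_volterra_dist.
Qed.

Lemma Lp_volterra_cyclic : cyclic_operator Lp_volterra.
Proof.
split; first exact: Lp_volterra_continuous.
pose e n : calL c hp := MkCalL (calL_of_continuous (@exp_tail01_continuous R n)).
have eE n : iter n Lp_volterra (Lclass (e 0%N)) = Lclass (e n).
  elim: n => // n IH; rewrite iterS IH Lp_volterraE; congr Lclass; apply/val_inj.
  exact: volterra01_exp_tail.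
exists (Lclass (e 0%N)); apply: dense_approx => x d d0.
have [n [a fa]] := exp_tail_dense_Lp d0 (valP (Lrepr x)).
exists (\sum_(i < n) a i *: iter i Lp_volterra (Lclass (e 0%N))).
  by exists n, a, (fun i => iter i Lp_volterra (Lclass (e 0%N))); split => // i; exists i.
have -> : \sum_(i < n) a i *: iter i Lp_volterra (Lclass (e 0%N)) =
    Lclass (\sum_(i < n) a i *: e i).
  elim/big_rec2: _ => [|i y1 y2 _ ->].
    by rewrite -[0 in RHS](subrr 0) -LclassB subrr.
  by rewrite LclassD LclassZ eE.
rewrite -[x]LreprK norm_LclassB.
apply: le_lt_trans fa; rewrite le_eqVlt; apply/orP; left; apply/eqP; congr Lpnorm.
apply/funext => t; congr (_ - _).
by elim/big_rec2: _ => // i y1 y2 _ <-.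
Qed.

End volterra_Lp.

Theorem corollary6p3 (R : realType) :
  (exists V : C01 R -> C01 R,
     (forall (f : C01 R) (x : I01 R), ((V f) x)%:E = volterra mu01 f x) /\
     cyclic_operator V)
  /\
  (forall (c : sigma_alg) (p : R) (hp : 1 <= p),
     exists V : Lp c hp -> Lp c hp,
       (forall f : calL c hp, exists g : calL c hp,
          (forall x : I01 R, (g x)%:E = volterra mu01 f x) /\
          V (Lclass f) = Lclass g) /\
       cyclic_operator V).
Proof.
split.
  exists C01_volterra; split; last exact: C01_volterra_cyclic.
  by move=> f x; exact: volterra_funE (C01_integrable01 Borel f).
move=> c p hp; exists (@Lp_volterra R c p hp); split; last exact: Lp_volterra_cyclic.
move=> f; exists (calL_volterra f); split; last exact: Lp_volterraE.
by move=> x; exact: volterra_funE (calL_integrable01 (valP f)).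
Qed.
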